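(* Let $b>a>0$ and let $f$ be a continuously differentiable function on the interval $[a,b]$. Then $$\begin{aligned}\sum_{a<n\le b}d(n)f(n)={}&\int_a^b(\log u+2\gamma)f(u)\,du-2\int_a^b\frac{f(u)\psi_2(\sqrt{u})}{u}\,du+\int_a^b\frac{f(u)\psi(\sqrt{u})}{\sqrt{u}}\,du\\&+4\int_a^b f(u)\left(\int_{\sqrt{u}}^{\infty}\frac{\psi_2(t)}{t^3}\,dt\right)du-f(b)\psi^2(\sqrt{b})+f(a)\psi^2(\sqrt{a})\\&+\int_a^b\psi^2(\sqrt{u})f'(u)\,du+2f(a)\sum_{m\le\sqrt{a}}\psi\left(\frac am\right)-2f(b)\sum_{m\le\sqrt{b}}\psi\left(\frac bm\right)\\&-\frac{1}{\pi i}\sum_{m\le\sqrt{b}}\ \sum_{|v|\ge1}\frac1v\int_{\max(m^2,a)}^{b}e^{\frac{2\pi i v u}{m}}f'(u)\,du.\end{aligned}$$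
   Context: For a positive integer $n$, $d(n)$ is the number of positive divisors of $n$. Sums over $n$ and $m$ run over positive integers, and the sum over $|v|\ge1$ runs over all nonzero integers $v$. $\gamma$ is Euler's constant. For real $u$, $[u]$ is the integral part of $u$, $\psi(u)=u-[u]-\tfrac12$, and $\psi_2(u)=\tfrac12B_2(u-[u])$, where $B_2(t)=t^2-t+\tfrac16$ is the Bernoulli polynomial of degree 2. $\psi^2(u)$ means $(\psi(u))^2$, and $f'$ is the derivative of $f$.
   Formalization: The term $\int_a^b f(u)\psi(\sqrt u)/\sqrt u\,du$ is taken with a minus sign instead of the printed plus; as printed the identity fails for $f=1$, $a=1/16$, $b=1/4$, where the left side is 0 and the right side is $-1/8$. *)

(* Defs.v *)
From Stdlib Require Import Reals ZArith.
From mathcomp Require seq prime.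
From Coquelicot Require Import Coquelicot.
Open Scope R_scope.

Definition num_divisors (n : nat) : nat := seq.size (prime.divisors n).

Definition euler_gamma : R :=
  real (Lim_seq (fun n => sum_n_m (fun k => / INR k) 1 n - ln (INR n))).

Definition psi (u : R) : R := u - IZR (Zfloor u) - 1 / 2.

Definition bernoulli2 (t : R) : R := t ^ 2 - t + 1 / 6.

Definition psi2 (u : R) : R := bernoulli2 (u - IZR (Zfloor u)) / 2.

Definition Cexp (z : C) : C :=
  (exp (Re z) * cos (Im z), exp (Re z) * sin (Im z)).

(* Sum over the integers n with x < n <= y, for x >= 0 (empty if y < x). *)
Definition sum_Ioc {G : AbelianMonoid} (F : nat -> G) (x y : R) : G :=
  sum_n_m F (S (Z.to_nat (Zfloor x))) (Z.to_nat (Zfloor y)).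

(* Sums over all nonzero integers are unordered: they are meant for families
   satisfying [nz_summable], i.e. absolutely convergent ones, so that grouping
   v with -v in [nz_sum] does not impose an order of summation. *)
Definition nz_summable (F : Z -> C) : Prop :=
  ex_series (fun k : nat =>
    Cmod (F (Z.of_nat (S k))) + Cmod (F (- Z.of_nat (S k))%Z)).

Definition nz_sum (F : Z -> C) : C :=
  let G := fun k : nat => (F (Z.of_nat (S k)) + F (- Z.of_nat (S k))%Z)%C in
  (Series (fun k => Re (G k)), Series (fun k => Im (G k))).

Definition RIntC (F : R -> C) (x y : R) : C :=
  RInt (V := C_R_CompleteNormedModule) F x y.

(* f is continuously differentiable on [a,b] with derivative f'.  Everything is
   relative to [a,b], so the derivative is one-sided at the endpoints and the
   values of f and f' outside [a,b] play no role. *)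
Definition C1_on (a b : R) (f f' : R -> C) : Prop :=
  (forall x : R, a <= x <= b ->
     filterdiff (U := R_NormedModule) (V := C_R_NormedModule)
       f (within (fun u => a <= u <= b) (locally x)) (fun h => scal h (f' x))) /\
  continuous_on (fun u => a <= u <= b) f'.

(* (1/v) * int_{max(m^2,a)}^b e^{2 pi i v u / m} f'(u) du *)
Definition fourier_term (a b : R) (f' : R -> C) (m : nat) (v : Z) : C :=
  (/ IZR v *
   RIntC (fun u => Cexp (2 * PI * Ci * IZR v * u / INR m) * f' u)
     (Rmax (INR m ^ 2)%R a) b)%C.

(* Main.v *)
Require Import Defs.
From Stdlib Require Import Reals ZArith Lra Lia Psatz.
From mathcomp Require all_boot zify.
From Coquelicot Require Import Coquelicot.
Open Scope R_scope.

(** Let [D u] be the sum of [d n] over [n <= u] and let [s] be the integral part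
    of [sqrt u]. The hyperbola method ([sum_num_divisors]) gives
    [D u = 2 (sum of the integral parts of u / m for m <= s) - s ^ 2], and
    replacing every integral part [x - 1/2 - psi x] gives [D = M - E], where
    [E u = psi (sqrt u) ^ 2 + 2 (sum of psi (u / m) for m <= sqrt u)] is
    [discrepancy] and the main term [M u = 2 u H(s) + u + 1/4 - (2 s + 1) sqrt u],
    with [H] the harmonic sum, turns out to be continuous. Integrating
    [((M - D) f)'] between consecutive integers, where [D] is constant, and
    collecting the jumps of [D] yields Abel summation in the form
    [sum of d n f n = int (M' f + E f') - E b f b + E a f a]
    ([is_RInt_divisor_sum]). Here [M' u = 2 H(s) + psi (sqrt u) / sqrt u], and
    Euler-Maclaurin summation expresses [H(s)] by [ln u], Euler's constant,
    [psi], [psi2] and the tail integral of [psi2 t / t ^ 3]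
    ([smooth_rate_expand]): these are the four integrals of [f] in the formula. In
    the integral of [E f'] the condition [m <= sqrt u] becomes the lower limit
    [max (m ^ 2) a] ([is_RInt_discrepancy]).

    It remains to write [2 int psi (u / m) f' u du] as a Fourier series. As [f'] is
    merely continuous, two facts about it are needed. Its Fourier coefficients
    divided by their index are absolutely summable, by an estimate of Bessel type
    ([fourier_coeff_sum_bounded]). And the partial sums of the sawtooth series
    converge to [psi] in the mean: the Dirichlet kernel bounds their error by
    [5 / (1 + N u) + 5 / (1 + N (1 - u))] on [(0, 1)] ([sawtooth_error_bound]),
    whose integral is of order [ln N / N].

    These arguments are carried out for real functions differentiable on the whole
    line. A complex [f] is treated through its real and imaginary parts, each
    extended beyond [[a, b]] by [C1_extension]. *)

(** * Integration of real functions *)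

(** [ring] and [field] recognize only equations whose type is syntactically
    [R]; rewriting with lemmas on abelian monoids leaves the carrier of
    [R_AbelianMonoid] there. *)
Ltac eq_in_R := match goal with |- _ ?x ?y => change (@eq R x y) end.

Lemma sum_n_m_Rplus (u v : nat -> R) (n m : nat) :
  sum_n_m (fun k => u k + v k) n m = sum_n_m u n m + sum_n_m v n m.
Proof. exact (sum_n_m_plus u v n m). Qed.

Lemma sum_n_m_Rmult (c : R) (u : nat -> R) (n m : nat) :
  sum_n_m (fun k => c * u k) n m = c * sum_n_m u n m.
Proof. exact (sum_n_m_mult_l (K := R_Ring) c u n m). Qed.

Lemma is_RInt_0 (x y : R) : is_RInt (fun _ => 0) x y 0.
Proof.
  pose proof (is_RInt_const (V := R_NormedModule) x y 0) as H.
  unfold scal in H; simpl in H. unfold mult in H; simpl in H.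
  now rewrite Rmult_0_r in H.
Qed.

Lemma is_RInt_Rplus (f g : R -> R) (x y I J : R) :
  is_RInt f x y I -> is_RInt g x y J -> is_RInt (fun u => f u + g u) x y (I + J).
Proof. exact (is_RInt_plus (V := R_NormedModule) f g x y I J). Qed.

Lemma is_RInt_Rmult (f : R -> R) (c x y I : R) :
  is_RInt f x y I -> is_RInt (fun u => c * f u) x y (c * I).
Proof. exact (is_RInt_scal (V := R_NormedModule) f x y c I). Qed.

Lemma ex_RInt_cont (h : R -> R) (x y : R) :
  (forall u, continuous h u) -> ex_RInt h x y.
Proof.
  intros Hh. apply (ex_RInt_continuous (V := R_CompleteNormedModule)).
  intros u _. apply Hh.
Qed.

Lemma is_RInt_cont (h : R -> R) (x y : R) :
  (forall u, continuous h u) -> is_RInt h x y (RInt h x y).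
Proof.
  intros Hh. apply (RInt_correct (V := R_CompleteNormedModule)), ex_RInt_cont, Hh.
Qed.

Lemma continuous_Rmult (g h : R -> R) (u : R) :
  continuous g u -> continuous h u -> continuous (fun v => g v * h v) u.
Proof. exact (continuous_mult (K := R_AbsRing) g h u). Qed.

Lemma is_RInt_sum_n_m (F : nat -> R -> R) (I : nat -> R) (x y : R) (n : nat) :
  (forall m, (1 <= m <= n)%nat -> is_RInt (F m) x y (I m)) ->
  is_RInt (fun u => sum_n_m (fun m => F m u) 1 n) x y (sum_n_m I 1 n).
Proof.
  induction n as [|n IH]; intros H.
  - rewrite sum_n_m_zero by lia.
    apply is_RInt_ext with (fun _ => zero).
    { intros u _. now rewrite sum_n_m_zero by lia. }
    apply is_RInt_0.
  - rewrite sum_n_Sm by lia.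
    apply is_RInt_ext with
      (fun u => plus (sum_n_m (fun m => F m u) 1 n) (F (S n) u)).
    { intros u _. now rewrite sum_n_Sm by lia. }
    apply (is_RInt_plus (V := R_NormedModule)).
    + apply IH. intros m Hm. apply H. lia.
    + apply H. lia.
Qed.

(** * Integral parts and cells between integers *)

(** The truncation that bounds [sum_Ioc]; on nonnegative reals it is the
    integral part. *)
Definition floorN (x : R) : nat := Z.to_nat (Zfloor x).

Lemma Zfloor_INR (n : nat) (x : R) :
  INR n <= x < INR (S n) -> Zfloor x = Z.of_nat n.
Proof.
  intros H. apply Zfloor_eq. rewrite <- INR_IZR_INZ. rewrite S_INR in H. lra.
Qed.

Lemma floorN_eq (n : nat) (x : R) : INR n <= x < INR (S n) -> floorN x = n.
Proof. intros H. unfold floorN. rewrite (Zfloor_INR n x H). lia. Qed.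

Lemma floorN_bound (x : R) : 0 <= x -> INR (floorN x) <= x < INR (S (floorN x)).
Proof.
  intros Hx. unfold floorN.
  assert (H0 : (0 <= Zfloor x)%Z) by (apply Zfloor_lub; lra).
  rewrite S_INR, INR_IZR_INZ, Z2Nat.id by exact H0. apply Zfloor_bound.
Qed.

Lemma floorN_INR (n : nat) : floorN (INR n) = n.
Proof. apply floorN_eq. rewrite S_INR. lra. Qed.

Lemma floorN_sqrt (n : nat) (u : R) :
  INR n <= u < INR (S n) -> floorN (sqrt u) = Nat.sqrt n.
Proof.
  intros [H1 H2]. apply floorN_eq.
  pose proof (Nat.sqrt_spec n (Nat.le_0_l n)) as [Hs1 Hs2].
  set (s := Nat.sqrt n) in *.
  pose proof (pos_INR s) as Hs. pose proof (pos_INR n) as Hn.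
  split.
  - rewrite <- (sqrt_square (INR s)) by lra. apply sqrt_le_1_alt.
    rewrite <- mult_INR. apply le_INR in Hs1. lra.
  - rewrite <- (sqrt_square (INR (S s))) by apply pos_INR. apply sqrt_lt_1_alt.
    rewrite <- mult_INR. split; [lra|].
    apply Rlt_le_trans with (1 := H2). apply le_INR. lia.
Qed.

Lemma floorN_div (n m : nat) (u : R) : (1 <= m)%nat ->
  INR n <= u < INR (S n) -> floorN (u / INR m) = (n / m)%nat.
Proof.
  intros Hm [H1 H2]. apply floorN_eq.
  assert (Hm' : 0 < INR m) by (apply lt_0_INR; lia).
  pose proof (Nat.div_mod n m ltac:(lia)) as Hd.
  pose proof (Nat.mod_upper_bound n m ltac:(lia)) as Hr.
  assert (A : INR m * INR (n / m) <= INR n)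
    by (rewrite <- mult_INR; apply le_INR; lia).
  assert (B : INR (S n) <= INR m * INR (S (n / m)))
    by (rewrite <- mult_INR; apply le_INR; nia).
  split.
  - apply Rmult_le_reg_l with (INR m); [lra|]. field_simplify; lra.
  - apply Rmult_lt_reg_l with (INR m); [lra|]. field_simplify; lra.
Qed.

Lemma psi_floorN (x : R) : 0 <= x -> psi x = x - INR (floorN x) - 1 / 2.
Proof.
  intros Hx. unfold psi. rewrite (Zfloor_INR _ _ (floorN_bound x Hx)).
  now rewrite <- INR_IZR_INZ.
Qed.

Lemma psi2_floorN (x : R) :
  0 <= x -> psi2 x = bernoulli2 (x - INR (floorN x)) / 2.
Proof.
  intros Hx. unfold psi2. rewrite (Zfloor_INR _ _ (floorN_bound x Hx)).
  now rewrite <- INR_IZR_INZ.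
Qed.

(** Every function of [u] in the formula is smooth between consecutive
    integers: a jump of [psi (sqrt u)] needs [u] to be a square, one of
    [psi (u / m)] needs a multiple of [m]. An identity that adds up over adjacent
    intervals therefore has to be checked only inside one cell [[n, n+1]], where
    the fundamental theorem of calculus applies. *)
Lemma cell_ind (P : R -> R -> Prop) :
  (forall x y z, 0 <= x -> x < y -> y < z -> P x y -> P y z -> P x z) ->
  (forall n x y, INR n <= x -> x < y -> y <= INR (S n) -> P x y) ->
  forall x y, 0 <= x -> x < y -> P x y.
Proof.
  intros Htrans Hcell x y Hx.
  destruct (floorN_bound x Hx) as [Hn1 Hn2]. set (n := floorN x) in *.
  assert (Hk : forall k z, x < z -> z <= INR (n + S k) -> P x z).
  { induction k as [|k IH]; intros z Hxz Hz.
    - apply (Hcell n); auto. now rewrite Nat.add_1_r in Hz.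
    - destruct (Rle_lt_dec z (INR (n + S k))) as [Hle|Hlt]; [now apply IH|].
      assert (Hw : x < INR (n + S k)).
      { apply Rlt_le_trans with (1 := Hn2). apply le_INR. lia. }
      apply Htrans with (INR (n + S k)); auto.
      + apply IH; auto. lra.
      + apply (Hcell (n + S k)%nat); auto; [lra|].
        now replace (S (n + S k)) with (n + S (S k))%nat by lia. }
  intros Hxy. destruct (floorN_bound y ltac:(lra)) as [_ Hm].
  apply (Hk (floorN y)); auto. apply Rlt_le. apply Rlt_le_trans with (1 := Hm).
  apply le_INR. lia.
Qed.

(** Values at the integers are left free, since they do not affect integrals;
    this makes the notion stable under sums and products. *)
Definition cellwise_continuous (h : R -> R) : Prop :=
  forall n : nat, exists k : R -> R,
    (forall u, 0 < u -> continuous k u) /\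
    (forall u, INR n < u < INR (S n) -> h u = k u).

Lemma ex_RInt_cellwise (h : R -> R) (x y : R) :
  cellwise_continuous h -> 0 < x -> x <= y -> ex_RInt h x y.
Proof.
  intros Hh Hx [Hxy|<-]; [|apply ex_RInt_point].
  pose proof (Rlt_le _ _ Hx) as Hx0. revert Hx. pattern x, y.
  apply cell_ind; [| |exact Hx0|exact Hxy].
  - intros u v w _ Huv Hvw H1 H2 Hu. apply ex_RInt_Chasles with v.
    + now apply H1.
    + apply H2. lra.
  - intros n u v H1 H2 H3 Hu. destruct (Hh n) as [k [Hk He]].
    apply ex_RInt_ext with k.
    + intros t. rewrite Rmin_left, Rmax_right by lra. intros Ht.
      symmetry. apply He. lra.
    + apply (ex_RInt_continuous (V := R_CompleteNormedModule)). intros t.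
      rewrite Rmin_left, Rmax_right by lra. intros Ht. apply Hk. lra.
Qed.

Lemma cellwise_of_continuous (h : R -> R) :
  (forall u, 0 < u -> continuous h u) -> cellwise_continuous h.
Proof. intros H n. now exists h. Qed.

Lemma cellwise_of_floor (h : R -> R) (c : nat -> R) :
  (forall n u, INR n <= u < INR (S n) -> h u = c n) -> cellwise_continuous h.
Proof.
  intros H n. exists (fun _ => c n). split.
  - intros u _. apply continuous_const.
  - intros u Hu. apply H. lra.
Qed.

Lemma cellwise_plus (g h : R -> R) :
  cellwise_continuous g -> cellwise_continuous h ->
  cellwise_continuous (fun u => g u + h u).
Proof.
  intros Hg Hh n. destruct (Hg n) as [k [Hk Ek]], (Hh n) as [l [Hl El]].
  exists (fun u => k u + l u). split.
  - intros u Hu. apply (continuous_plus k l); auto.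
  - intros u Hu. now rewrite Ek, El.
Qed.

Lemma cellwise_mult (g h : R -> R) :
  cellwise_continuous g -> cellwise_continuous h ->
  cellwise_continuous (fun u => g u * h u).
Proof.
  intros Hg Hh n. destruct (Hg n) as [k [Hk Ek]], (Hh n) as [l [Hl El]].
  exists (fun u => k u * l u). split.
  - intros u Hu. apply (continuous_mult k l); auto.
  - intros u Hu. now rewrite Ek, El.
Qed.

Lemma cellwise_ext (g h : R -> R) :
  (forall u, 0 < u -> g u = h u) ->
  cellwise_continuous g -> cellwise_continuous h.
Proof.
  intros He Hg n. destruct (Hg n) as [k [Hk Ek]]. exists k. split; [exact Hk|].
  intros u Hu. rewrite <- He; auto. pose proof (pos_INR n). lra.
Qed.

Lemma cellwise_derivable (h : R -> R) :
  (forall u, 0 < u -> ex_derive h u) -> cellwise_continuous h.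
Proof.
  intros H. apply cellwise_of_continuous. intros u Hu.
  now apply (ex_derive_continuous (V := R_NormedModule)), H.
Qed.

Lemma cellwise_inv : cellwise_continuous (fun u => / u).
Proof. apply cellwise_derivable. intros u Hu. auto_derive. lra. Qed.

Lemma cellwise_inv_sqrt : cellwise_continuous (fun u => / sqrt u).
Proof.
  apply cellwise_derivable. intros u Hu. pose proof (sqrt_lt_R0 u Hu).
  auto_derive. lra.
Qed.

Lemma cellwise_log_weight : cellwise_continuous (fun u => ln u + 2 * euler_gamma).
Proof. apply cellwise_derivable. intros u Hu. auto_derive. lra. Qed.

(** * Euler's constant and the tail of psi2 *)

Definition harmonic (n : nat) : R := sum_n_m (fun k => / INR k) 1 n.

Lemma harmonic_S (n : nat) : harmonic (S n) = harmonic n + / INR (S n).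
Proof. unfold harmonic. rewrite sum_n_Sm by lia. reflexivity. Qed.

Lemma ln_ratio_bound (n : nat) : (1 <= n)%nat ->
  / INR (S n) <= ln (INR (S n)) - ln (INR n) <= / INR n.
Proof.
  intros Hn. assert (Hp : 0 < INR n) by (apply lt_0_INR; lia).
  assert (Hq : 0 < INR (S n)) by (apply lt_0_INR; lia).
  assert (Hln : forall x, 0 < x -> ln x <= x - 1).
  { intros x Hx. pose proof (exp_ineq1_le (ln x)). rewrite exp_ln in H; lra. }
  assert (A : ln (INR (S n)) - ln (INR n) = ln (INR (S n) / INR n)).
  { rewrite ln_div; lra. }
  assert (B : ln (INR (S n)) - ln (INR n) = - ln (INR n / INR (S n))).
  { rewrite ln_div; lra. }
  split.
  - rewrite B. pose proof (Hln (INR n / INR (S n)) ltac:(now apply Rdiv_lt_0_compat)).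
    assert (INR n / INR (S n) = 1 - / INR (S n)).
    { rewrite S_INR in *. field. lra. }
    lra.
  - rewrite A. pose proof (Hln (INR (S n) / INR n) ltac:(now apply Rdiv_lt_0_compat)).
    assert (INR (S n) / INR n = 1 + / INR n).
    { rewrite S_INR in *. field. lra. }
    lra.
Qed.

Lemma euler_gamma_lim :
  is_lim_seq (fun n => harmonic n - ln (INR n)) euler_gamma.
Proof.
  apply (Lim_seq_correct' (fun n => harmonic n - ln (INR n))).
  destruct (ex_finite_lim_seq_decr
    (fun n => harmonic (S n) - ln (INR (S n))) 0) as [l Hl].
  - intros n. rewrite (harmonic_S (S n)).
    pose proof (ln_ratio_bound (S n) ltac:(lia)). lra.
  - intros n. assert (H : ln (INR (S (S n))) <= harmonic (S n)).
    { induction n as [|n IH].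
      - unfold harmonic. rewrite sum_n_n.
        pose proof (ln_ratio_bound 1 ltac:(lia)) as [_ H].
        change (INR 1) with 1 in *. rewrite ln_1 in H. lra.
      - rewrite harmonic_S. pose proof (ln_ratio_bound (S (S n)) ltac:(lia)). lra. }
    pose proof (ln_ratio_bound (S n) ltac:(lia)).
    assert (0 < / INR (S (S n))) by (apply Rinv_0_lt_compat, lt_0_INR; lia). lra.
  - exists l. now apply is_lim_seq_incr_1.
Qed.

(** The closed form of the integral of [psi2 t / t ^ 3] over [[y, +oo)]: it is
    Euler-Maclaurin summation for the harmonic sum, solved for the remainder. *)
Definition psi2_tail (y : R) : R :=
  (harmonic (floorN y) - ln y - euler_gamma + psi y / y + psi2 y / y ^ 2) / 2.

(** The expression of [psi2_tail] on the closed cell [[n, n+1]]. *)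
Definition tail_branch (n : nat) (t : R) : R :=
  (harmonic n - ln t - euler_gamma + 3 / 2 - (2 * INR n + 1) / t
   + (INR n ^ 2 + INR n + 1 / 6) / (2 * t ^ 2)) / 2.

(** The branches agree at the integers: at [t = n+1] the jump [1 / (n+1)] of the
    harmonic sum cancels the jump of [psi t / t], and [psi2] is continuous. *)
Lemma psi2_tail_branch (n : nat) (t : R) :
  0 < t -> INR n <= t <= INR (S n) -> psi2_tail t = tail_branch n t.
Proof.
  intros Ht [H1 H2]. unfold psi2_tail, tail_branch.
  rewrite psi_floorN, psi2_floorN by lra. unfold bernoulli2.
  destruct H2 as [H2| ->].
  - rewrite (floorN_eq n t) by lra. field. lra.
  - rewrite floorN_INR, harmonic_S. rewrite S_INR in *. field. lra.
Qed.

Lemma is_RInt_psi2_cube (x y : R) : 0 < x -> x < y ->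
  is_RInt (fun t => psi2 t / t ^ 3) x y (psi2_tail x - psi2_tail y).
Proof.
  intros Hx Hxy. pose proof (Rlt_le _ _ Hx) as Hx0. revert Hx. pattern x, y.
  apply cell_ind; [| |exact Hx0|exact Hxy]; clear x y Hxy Hx0.
  - intros x y z _ Hxy Hyz H1 H2 Hx.
    replace (psi2_tail x - psi2_tail z)
      with (plus (psi2_tail x - psi2_tail y) (psi2_tail y - psi2_tail z))
      by (unfold plus; simpl; ring).
    apply (is_RInt_Chasles (V := R_NormedModule) _ x y z); [now apply H1|apply H2; lra].
  - intros n x y H1 Hxy H2 Hx.
    rewrite !(psi2_tail_branch n) by lra.
    replace (tail_branch n x - tail_branch n y)
      with (minus (- tail_branch n y) (- tail_branch n x))
      by (unfold minus, plus, opp; simpl; ring).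
    apply is_RInt_ext with (fun t => bernoulli2 (t - INR n) / 2 / t ^ 3).
    { intros t. rewrite Rmin_left, Rmax_right by lra. intros Ht.
      rewrite psi2_floorN, (floorN_eq n t); lra. }
    apply (is_RInt_derive (V := R_CompleteNormedModule) (fun t => - tail_branch n t)).
    + intros t. rewrite Rmin_left, Rmax_right by lra. intros Ht.
      unfold tail_branch, bernoulli2. auto_derive.
      { repeat split; try lra. nra. }
      field. lra.
    + intros t. rewrite Rmin_left, Rmax_right by lra. intros Ht.
      apply (ex_derive_continuous (V := R_NormedModule)). unfold bernoulli2.
      auto_derive. assert (0 < t ^ 3) by (apply pow_lt; lra). simpl in *; lra.
Qed.

Lemma psi_bound (x : R) : - (1 / 2) <= psi x <= 1 / 2.
Proof. unfold psi. pose proof (Zfloor_bound x). lra. Qed.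

Lemma psi2_bound (x : R) : - 1 <= psi2 x <= 1.
Proof. unfold psi2, bernoulli2. pose proof (Zfloor_bound x). nra. Qed.

(** This is where the constant in [psi2_tail] is identified as Euler's constant:
    [harmonic n - ln n] tends to it, and the sawtooth terms are at most [1 / y]. *)
Lemma psi2_tail_to_0 (eps : posreal) :
  exists Y, 0 < Y /\ forall y, Y < y -> Rabs (psi2_tail y) < eps.
Proof.
  destruct (proj2 (is_lim_seq_spec _ _) euler_gamma_lim eps) as [N HN].
  exists (Rmax (INR (S N)) (4 / eps + 1)).
  pose proof (cond_pos eps) as He.
  assert (H4 : 0 < 4 / eps) by (apply Rdiv_lt_0_compat; lra).
  pose proof (Rmax_l (INR (S N)) (4 / eps + 1)).
  pose proof (Rmax_r (INR (S N)) (4 / eps + 1)).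
  pose proof (pos_INR (S N)).
  split; [lra|]. intros y Hy.
  destruct (floorN_bound y ltac:(lra)) as [Hn1 Hn2]. set (n := floorN y) in *.
  assert (HNn : (S N <= n)%nat).
  { apply Nat.lt_succ_r. apply INR_lt. lra. }
  specialize (HN n ltac:(lia)). simpl in HN.
  assert (Hp : 0 < INR n) by (apply lt_0_INR; lia).
  assert (Hy4 : 1 / y < eps / 4).
  { apply Rmult_lt_reg_l with (y * (4 / eps)); [apply Rmult_lt_0_compat; lra|].
    replace (y * (4 / eps) * (1 / y)) with (4 / eps) by (field; lra).
    replace (y * (4 / eps) * (eps / 4)) with y by (field; lra). lra. }
  assert (Hln : 0 <= ln y - ln (INR n) <= / INR n).
  { split.
    - pose proof (ln_le (INR n) y ltac:(lra) ltac:(lra)). lra.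
    - pose proof (ln_ratio_bound n ltac:(lia)).
      pose proof (ln_le y (INR (S n)) ltac:(lra) ltac:(lra)). lra. }
  assert (Hin : / INR n <= 2 * (1 / y)).
  { apply Rmult_le_reg_l with (INR n * y); [apply Rmult_lt_0_compat; lra|].
    assert (1 <= INR n) by (change 1 with (INR 1); apply le_INR; lia).
    rewrite S_INR in Hn2. field_simplify; lra. }
  assert (Hpsi : Rabs (psi y / y) <= 1 / 2 * (1 / y)).
  { unfold Rdiv at 1. rewrite Rabs_mult, (Rabs_right (/ y)).
    - replace (1 / y) with (/ y) by (field; lra).
      apply Rmult_le_compat_r; [left; apply Rinv_0_lt_compat; lra|].
      apply Rabs_le. apply psi_bound.
    - left; apply Rinv_0_lt_compat; lra. }
  assert (Hpsi2 : Rabs (psi2 y / y ^ 2) <= 1 * (1 / y)).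
  { unfold Rdiv at 1. rewrite Rabs_mult.
    assert (Hi : 0 < / y ^ 2) by (apply Rinv_0_lt_compat, pow_lt; lra).
    rewrite (Rabs_right (/ y ^ 2)) by lra.
    assert (/ y ^ 2 <= 1 / y).
    { apply Rmult_le_reg_l with (y ^ 2); [apply pow_lt; lra|].
      field_simplify; try lra. }
    assert (Hp2 : Rabs (psi2 y) <= 1).
    { apply Rabs_le. pose proof (psi2_bound y). lra. }
    apply Rle_trans with (1 * / y ^ 2); [apply Rmult_le_compat_r|]; lra. }
  unfold psi2_tail. fold n.
  apply Rabs_def2 in HN. apply Rabs_le_between in Hpsi, Hpsi2.
  apply Rabs_def1; lra.
Qed.

Lemma RInt_gen_psi2_tail (y : R) : 0 < y ->
  RInt_gen (fun t => psi2 t / t ^ 3)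
    (at_point y) (Rbar_locally p_infty) = psi2_tail y.
Proof.
  intros Hy. apply is_RInt_gen_unique. intros P [eps HP].
  destruct (psi2_tail_to_0 eps) as [Y [HY HY']].
  apply Filter_prod with (fun x => x = y) (fun z => Rmax Y y < z).
  - reflexivity.
  - now exists (Rmax Y y).
  - intros x z -> Hz. simpl. exists (psi2_tail y - psi2_tail z).
    pose proof (Rmax_l Y y). pose proof (Rmax_r Y y). split.
    + apply is_RInt_psi2_cube; lra.
    + apply HP. unfold ball; simpl. unfold AbsRing_ball, abs, minus, plus, opp; simpl.
      replace (psi2_tail y - psi2_tail z + - psi2_tail y) with (- psi2_tail z) by ring.
      rewrite Rabs_Ropp. apply HY'. lra.
Qed.

(** * The divisor function and the hyperbola method *)

(** The module keeps the arithmetic notations of its imports local. *)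
Module Divisors.
Import all_boot zify.
Local Open Scope nat_scope.

Definition small_divisors (n : nat) : seq nat :=
  [seq m <- divisors n | m * m < n].

(** The involution [m |-> n / m] exchanges the divisors below and above the
    square root of [n]. *)
Lemma size_divisors (n : nat) : 0 < n ->
  size (divisors n) =
  2 * size (small_divisors n) + size [seq m <- divisors n | m * m == n].
Proof.
move=> n0.
have E : perm_eq [seq m <- divisors n | n < m * m]
                 [seq n %/ m | m <- small_divisors n].
  have inv m : m %| n -> n %/ (n %/ m) = m.
    move=> /dvdnP [k kE]; rewrite kE in n0 *.
    have [k0 m0] : 0 < k /\ 0 < m by split; nia.
    by rewrite mulnK // mulKn.
  apply: uniq_perm.
  - by rewrite filter_uniq // divisors_uniq.
  - rewrite map_inj_in_uniq ?filter_uniq ?divisors_uniq // => x y.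
    rewrite !mem_filter -!dvdn_divisors // => /andP[_ dx] /andP[_ dy] e.
    by rewrite -(inv x dx) e inv.
  - move=> m; rewrite mem_filter -dvdn_divisors //.
    apply/andP/mapP.
    + move=> [lt dm]; exists (n %/ m); last by rewrite inv.
      rewrite mem_filter -dvdn_divisors // dvdn_div // andbT.
      case/dvdnP: dm => k kE; rewrite kE in n0 lt *.
      have m0 : 0 < m by nia.
      by rewrite mulnK //; nia.
    + move=> [k]; rewrite mem_filter -dvdn_divisors // => /andP[lt dk] ->.
      split; last exact: dvdn_div.
      case/dvdnP: dk => j jE; rewrite jE in n0 lt *.
      have k0 : 0 < k by nia.
      by rewrite mulnK //; nia.
have C : size (divisors n) = size [seq m <- divisors n | m * m < n] +
  size [seq m <- divisors n | n < m * m] + size [seq m <- divisors n | m * m == n].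
  by elim: (divisors n) => //= m s ->; case: (ltngtP (m * m) n) => _ /=; lia.
rewrite C (perm_size E) size_map /small_divisors; lia.
Qed.

Lemma divnE_Nat (n m : nat) : n %/ m = Nat.div n m.
Proof.
case: m => [//|m]; apply: (Nat.div_unique _ _ _ (n %% m.+1)).
  by apply/ltP; rewrite ltn_mod.
by rewrite [LHS](divn_eq n m.+1) mulnC.
Qed.

(** The quotient [n / m] grows by one when [n] passes to a multiple of [m] and
    stays constant otherwise. *)
Lemma size_small_divisors (n : nat) :
  size (small_divisors n.+1) =
  sumn [seq Nat.div n.+1 m - Nat.div n m | m <- iota 1 (Nat.sqrt n)].
Proof.
have [s1 s2] := Nat.sqrt_spec n (Nat.le_0_l n).
have E : perm_eq (small_divisors n.+1) [seq m <- iota 1 (Nat.sqrt n) | m %| n.+1].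
  apply: uniq_perm; rewrite ?filter_uniq ?divisors_uniq ?iota_uniq // => m.
  rewrite !mem_filter -dvdn_divisors // mem_iota andbC.
  case D: (m %| n.+1) => //=.
  have m0 : 0 < m by apply: dvdn_gt0 D.
  apply/idP/andP; nia.
rewrite (perm_size E) size_filter.
have: all (fun m => 0 < m) (iota 1 (Nat.sqrt n)).
  by apply/allP => m; rewrite mem_iota => /andP[].
elim: (iota _ _) => //= m s IH /andP[m0 /IH ->].
by rewrite -!divnE_Nat divnS // addnK.
Qed.

Lemma size_square_divisors (n : nat) :
  size [seq m <- divisors n.+1 | m * m == n.+1] + Nat.sqrt n = Nat.sqrt n.+1.
Proof.
have [s1 s2] := Nat.sqrt_spec n (Nat.le_0_l n).
have [r1 r2] := Nat.sqrt_spec n.+1 (Nat.le_0_l n.+1).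
set s := Nat.sqrt n in s1 s2 *; set r := Nat.sqrt n.+1 in r1 r2 *.
case: (eqVneq (r * r) n.+1) => e.
- have E : perm_eq [seq m <- divisors n.+1 | m * m == n.+1] [:: r].
    apply: uniq_perm; rewrite ?filter_uniq ?divisors_uniq // => m.
    rewrite mem_filter -dvdn_divisors // inE.
    apply/andP/eqP => [[/eqP em _]|->]; first by nia.
    by rewrite e -[X in _ %| X]e dvdn_mulr.
  by rewrite (perm_size E) /=; nia.
- rewrite size_filter (eq_in_count (a2 := pred0)) ?count_pred0; first by nia.
  by move=> m _ /=; apply/eqP => em; move/eqP: e; apply; have -> : r = m by nia.
Qed.

Lemma num_divisors_succ (n : nat) :
  num_divisors n.+1 + Nat.sqrt n =
  2 * sumn [seq Nat.div n.+1 m - Nat.div n m | m <- iota 1 (Nat.sqrt n)]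
  + Nat.sqrt n.+1.
Proof.
rewrite /num_divisors size_divisors // size_small_divisors.
by rewrite -addnA size_square_divisors.
Qed.

Lemma INR_sumn_iota (F : nat -> nat) (s : nat) :
  INR (sumn [seq F m | m <- iota 1 s]) = sum_n_m (fun m => INR (F m)) 1 s.
Proof.
elim: s => [|s IH].
  by rewrite sum_n_m_zero //; apply/ltP.
rewrite -[in LHS](addn1 s) iotaD map_cat sumn_cat plus_INR IH /= addn0 add1n.
by rewrite sum_n_Sm //; lia.
Qed.
End Divisors.

Lemma num_divisors_S (n : nat) :
  INR (num_divisors (S n)) =
  2 * sum_n_m (fun m => INR (S n / m) - INR (n / m)) 1 (Nat.sqrt n)
  + INR (Nat.sqrt (S n)) - INR (Nat.sqrt n).
Proof.
  pose proof (f_equal INR (Divisors.num_divisors_succ n)) as H.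
  change ssrnat.addn with Nat.add in H. change ssrnat.muln with Nat.mul in H.
  change ssrnat.subn with Nat.sub in H.
  rewrite !plus_INR, mult_INR, Divisors.INR_sumn_iota in H.
  change (INR 2) with 2 in H.
  rewrite (sum_n_m_ext_loc _ (fun m => INR (S n / m) - INR (n / m))) in H.
  - lra.
  - intros m Hm. apply minus_INR. apply Nat.Div0.div_le_mono. lia.
Qed.

(** Dirichlet's hyperbola method: *)
(** Dirichlet's hyperbola method, by induction on [n]: passing from [n] to [n+1]
    raises each quotient [n / m] by one exactly when [m] divides [n+1], and when
    [n+1] is a square the new term of the sum and the change of the square
    account for the middle divisor. *)
Lemma sum_num_divisors (n : nat) :
  sum_n_m (fun k => INR (num_divisors k)) 1 n =
  2 * sum_n_m (fun m => INR (n / m)) 1 (Nat.sqrt n) - INR (Nat.sqrt n) ^ 2.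
Proof.
  induction n as [|n IH].
  - change (Nat.sqrt 0) with 0%nat. rewrite !sum_n_m_zero by lia.
    change (@zero R_AbelianMonoid) with 0. simpl. ring.
  - rewrite sum_n_Sm by lia. rewrite IH, num_divisors_S.
    change plus with Rplus.
    assert (E : sum_n_m (fun m => INR (S n / m)) 1 (Nat.sqrt n) =
      sum_n_m (fun m => INR (n / m)) 1 (Nat.sqrt n) +
      sum_n_m (fun m => INR (S n / m) - INR (n / m)) 1 (Nat.sqrt n)).
    { rewrite <- (sum_n_m_plus (G := R_AbelianMonoid)).
      apply sum_n_m_ext. intros m. unfold plus; simpl. lra. }
    destruct (Nat.sqrt_succ_or n) as [Hs|Hs].
    + pose proof (Nat.sqrt_spec n (Nat.le_0_l n)) as Hn.
      pose proof (Nat.sqrt_spec (S n) (Nat.le_0_l (S n))) as HSn.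
      assert (Hr : S n = (S (Nat.sqrt n) * S (Nat.sqrt n))%nat) by (rewrite Hs in HSn; lia).
      rewrite Hs, sum_n_Sm by lia. rewrite E. change plus with Rplus.
      replace (S n / S (Nat.sqrt n))%nat with (S (Nat.sqrt n)).
      2:{ rewrite Hr; now rewrite Nat.div_mul by discriminate. }
      rewrite S_INR. lra.
    + rewrite Hs, E. lra.
Qed.

(** * The discrepancy and Abel summation *)

(** The difference between the continuous main term of the divisor summatory
    function and that function itself; see [discrepancy_cell]. *)
Definition discrepancy (u : R) : R :=
  psi (sqrt u) ^ 2
  + 2 * sum_n_m (fun m => psi (u / INR m)) 1 (floorN (sqrt u)).

(** The derivative, off the integers, of the main term of the divisor summatory
    function. *)
Definition smooth_rate (u : R) : R :=
  2 * harmonic (floorN (sqrt u)) + psi (sqrt u) / sqrt u.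

(** Main term minus divisor sum on the cell [[n, n+1]], with [sqrt n] truncated.
    The last line is constant there, the others are the main term. *)
Definition discrepancy_branch (n : nat) (u : R) : R :=
  2 * u * harmonic (Nat.sqrt n) + u + 1 / 4
  - (2 * INR (Nat.sqrt n) + 1) * sqrt u
  - sum_n_m (fun k => INR (num_divisors k)) 1 n.

(** Writing each integral part in the hyperbola formula as
    [x - 1 / 2 - psi x] expresses the divisor sum through [psi]. *)
Lemma discrepancy_cell (n : nat) (u : R) : INR n <= u < INR (S n) ->
  discrepancy u = discrepancy_branch n u.
Proof.
  intros Hu. pose proof (pos_INR n) as Hn.
  unfold discrepancy, discrepancy_branch.
  rewrite psi_floorN by apply sqrt_pos. rewrite (floorN_sqrt n u Hu).
  rewrite sum_num_divisors. set (s := Nat.sqrt n).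
  assert (E : sum_n_m (fun m => psi (u / INR m)) 1 s =
    u * harmonic s - 1 / 2 * INR s - sum_n_m (fun m => INR (n / m)) 1 s).
  { rewrite (sum_n_m_ext_loc _
      (fun m => u * / INR m + (- (1 / 2) + -1 * INR (n / m)))).
    - unfold harmonic.
      rewrite !sum_n_m_Rplus, !sum_n_m_Rmult, sum_n_m_const.
      replace (S s - 1)%nat with s by lia.
      eq_in_R. ring.
    - intros m Hm. assert (0 < INR m) by (apply lt_0_INR; lia).
      rewrite psi_floorN.
      + rewrite (floorN_div n m u) by (lia || lra). eq_in_R. unfold Rdiv. ring.
      + apply Rle_mult_inv_pos; lra. }
  rewrite E.
  assert (Hs : sqrt u * sqrt u = u) by (apply sqrt_sqrt; lra).
  revert Hs. generalize (sqrt u). intros v <-. field.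
Qed.

(** The main term is continuous, also where [n+1] is a square; so only the
    divisor sum jumps. *)
Lemma discrepancy_branch_succ (n : nat) :
  discrepancy_branch n (INR (S n)) =
  discrepancy_branch (S n) (INR (S n)) + INR (num_divisors (S n)).
Proof.
  unfold discrepancy_branch. rewrite (sum_n_Sm _ 1 n) by lia.
  change plus with Rplus.
  destruct (Nat.sqrt_succ_or n) as [Hs|Hs]; rewrite Hs; [|lra].
  pose proof (Nat.sqrt_spec n (Nat.le_0_l n)) as Hn.
  pose proof (Nat.sqrt_spec (S n) (Nat.le_0_l (S n))) as HSn.
  assert (Hr : S n = (S (Nat.sqrt n) * S (Nat.sqrt n))%nat) by (rewrite Hs in HSn; lia).
  set (s := Nat.sqrt n) in *.
  rewrite harmonic_S, Hr, mult_INR, sqrt_square by apply pos_INR.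
  rewrite !S_INR. pose proof (pos_INR s). field. lra.
Qed.

Definition harmonic_rate (n : nat) (u : R) : R :=
  2 * harmonic (Nat.sqrt n) + 1 - (INR (Nat.sqrt n) + 1 / 2) / sqrt u.

Lemma smooth_rate_cell (n : nat) (u : R) : 0 < u -> INR n <= u < INR (S n) ->
  smooth_rate u = harmonic_rate n u.
Proof.
  intros Hu Hn. unfold smooth_rate, harmonic_rate.
  rewrite psi_floorN by apply sqrt_pos. rewrite (floorN_sqrt n u Hn).
  pose proof (sqrt_lt_R0 u Hu). field. lra.
Qed.

Lemma sum_Ioc_Chasles (F : nat -> R) (x y z : R) : 0 <= x -> x <= y -> y <= z ->
  sum_Ioc F x z = sum_Ioc F x y + sum_Ioc F y z.
Proof.
  intros Hx Hxy Hyz. unfold sum_Ioc.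
  pose proof (Zfloor_le _ _ Hxy). pose proof (Zfloor_le _ _ Hyz).
  apply (sum_n_m_Chasles (G := R_AbelianMonoid)); lia.
Qed.

(** Abel summation. On one cell the integrand is the derivative of
    [discrepancy_branch n u * phi u]; at the right end of the cell this branch
    exceeds [discrepancy] by [num_divisors (n+1)]. *)
Lemma is_RInt_divisor_sum (phi phi' : R -> R) (x y : R) :
  (forall u, is_derive phi u (phi' u)) -> (forall u, continuous phi' u) ->
  0 < x -> x < y ->
  is_RInt (fun u => smooth_rate u * phi u + discrepancy u * phi' u) x y
    (sum_Ioc (fun n => INR (num_divisors n) * phi (INR n)) x y
     + discrepancy y * phi y - discrepancy x * phi x).
Proof.
  intros Hphi Hphi' Hx Hxy. pose proof (Rlt_le _ _ Hx) as Hx0. revert Hx. pattern x, y.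
  apply cell_ind; [| |exact Hx0|exact Hxy]; clear x y Hxy Hx0.
  - intros x y z _ Hxy Hyz H1 H2 Hx.
    rewrite (sum_Ioc_Chasles _ x y z) by lra.
    specialize (H1 Hx). specialize (H2 ltac:(lra)).
    pose proof (is_RInt_Chasles (V := R_NormedModule) _ x y z _ _ H1 H2) as H.
    revert H. unfold plus; simpl.
    match goal with |- is_RInt _ _ _ ?p -> is_RInt _ _ _ ?q =>
      replace p with q by ring end. auto.
  - intros n x y H1 Hxy H2 Hx.
    assert (E : sum_Ioc (fun n => INR (num_divisors n) * phi (INR n)) x y
       + discrepancy y * phi y = discrepancy_branch n y * phi y).
    { unfold sum_Ioc. fold (floorN x) (floorN y).
      rewrite (floorN_eq n x) by lra. destruct H2 as [H2| ->].
      - rewrite (floorN_eq n y), (discrepancy_cell n y) by lra.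
        rewrite sum_n_m_zero by lia. unfold zero; simpl; ring.
      - rewrite floorN_INR, sum_n_n.
        rewrite (discrepancy_cell (S n)) by (rewrite (S_INR (S n)); lra).
        rewrite discrepancy_branch_succ. ring. }
    rewrite E, (discrepancy_cell n x) by lra.
    apply is_RInt_ext with (fun u => harmonic_rate n u * phi u
      + discrepancy_branch n u * phi' u).
    { intros u. rewrite Rmin_left, Rmax_right by lra. intros Hu.
      now rewrite (smooth_rate_cell n u), (discrepancy_cell n u) by lra. }
    apply (is_RInt_scal_derive (V := R_CompleteNormedModule)
      (discrepancy_branch n) phi (harmonic_rate n) phi');
      intros u; rewrite Rmin_left, Rmax_right by lra; intros Hu.
    + pose proof (sqrt_lt_R0 u ltac:(lra)).
      unfold discrepancy_branch, harmonic_rate. auto_derive; [lra|]. field. lra.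
    + apply Hphi.
    + apply (ex_derive_continuous (V := R_NormedModule)). unfold harmonic_rate.
      pose proof (sqrt_lt_R0 u ltac:(lra)). auto_derive. split; lra.
    + apply Hphi'.
Qed.

(** * The formula for real functions *)

Lemma cellwise_psi_sqrt : cellwise_continuous (fun u => psi (sqrt u)).
Proof.
  apply cellwise_ext with (fun u => (sqrt u - 1 / 2) + - INR (floorN (sqrt u))).
  - intros u Hu. rewrite psi_floorN by apply sqrt_pos. ring.
  - apply cellwise_plus.
    + apply cellwise_derivable. intros u Hu. auto_derive. lra.
    + apply (cellwise_of_floor _ (fun n => - INR (Nat.sqrt n))).
      intros n u Hu. now rewrite (floorN_sqrt n u).
Qed.

Lemma cellwise_psi_sqrt_sqr : cellwise_continuous (fun u => psi (sqrt u) ^ 2).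
Proof.
  apply cellwise_ext with (fun u => psi (sqrt u) * psi (sqrt u)).
  { intros; simpl; ring. }
  apply cellwise_mult; apply cellwise_psi_sqrt.
Qed.

Lemma psi2_psi (x : R) : psi2 x = psi x * psi x * (1 / 2) + - (1 / 24).
Proof. unfold psi2, psi, bernoulli2. field. Qed.

Lemma cellwise_psi2_sqrt : cellwise_continuous (fun u => psi2 (sqrt u)).
Proof.
  apply cellwise_ext
    with (fun u => psi (sqrt u) * psi (sqrt u) * (1 / 2) + - (1 / 24)).
  - intros u _. now rewrite psi2_psi.
  - apply cellwise_plus; [apply cellwise_mult; [apply cellwise_mult|]|];
      try apply cellwise_psi_sqrt;
      apply cellwise_of_continuous; intros u _; apply continuous_const.
Qed.

Lemma cellwise_psi_div (m : nat) :
  (1 <= m)%nat -> cellwise_continuous (fun u => psi (u / INR m)).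
Proof.
  intros Hm. assert (Hm' : 0 < INR m) by (apply lt_0_INR; lia).
  apply cellwise_ext
    with (fun u => (u / INR m - 1 / 2) + - INR (floorN (u / INR m))).
  - intros u Hu. rewrite psi_floorN; [ring|]. apply Rle_mult_inv_pos; lra.
  - apply cellwise_plus.
    + apply cellwise_derivable. intros u Hu. auto_derive. lra.
    + apply (cellwise_of_floor _ (fun n => - INR (n / m))).
      intros n u Hu. now rewrite (floorN_div n m u).
Qed.

Lemma cellwise_tail_sqrt : cellwise_continuous (fun u => psi2_tail (sqrt u)).
Proof.
  apply cellwise_ext with (fun u =>
    (harmonic (floorN (sqrt u)) + (- ln (sqrt u) - euler_gamma)
     + psi (sqrt u) * / sqrt u + psi2 (sqrt u) * / sqrt u ^ 2) * / 2).
  - intros u _. unfold psi2_tail, Rdiv. ring.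
  - apply cellwise_mult;
      [apply cellwise_plus;
        [apply cellwise_plus; [apply cellwise_plus|apply cellwise_mult]
        |apply cellwise_mult]|].
    + apply (cellwise_of_floor _ (fun n => harmonic (Nat.sqrt n))).
      intros n u Hu. now rewrite (floorN_sqrt n u).
    + apply cellwise_derivable. intros u Hu.
      pose proof (sqrt_lt_R0 u Hu). auto_derive. lra.
    + apply cellwise_psi_sqrt.
    + apply cellwise_inv_sqrt.
    + apply cellwise_psi2_sqrt.
    + apply cellwise_derivable. intros u Hu.
      pose proof (sqrt_lt_R0 u Hu). auto_derive. split; nra.
    + apply cellwise_of_continuous; intros u _; apply continuous_const.
Qed.

(** Solving the definition of [psi2_tail] for the harmonic sum makes Euler's
    constant and the four weights of the formula appear. *)
Lemma smooth_rate_expand (u : R) : 0 < u ->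
  smooth_rate u = ln u + 2 * euler_gamma - 2 * (psi2 (sqrt u) / u)
    - psi (sqrt u) / sqrt u + 4 * psi2_tail (sqrt u).
Proof.
  intros Hu. pose proof (sqrt_lt_R0 u Hu) as Hs.
  pose proof (sqrt_sqrt u (Rlt_le _ _ Hu)) as Hss.
  unfold smooth_rate, psi2_tail.
  assert (Hln : ln u = 2 * ln (sqrt u)).
  { rewrite <- Hss at 1. rewrite ln_mult by lra. ring. }
  rewrite Hln.
  replace (psi2 (sqrt u) / u) with (psi2 (sqrt u) / (sqrt u * sqrt u))
    by now rewrite Hss.
  field. lra.
Qed.

Lemma le_floorN_sqrt (m : nat) (u : R) : 0 <= u ->
  (m <= floorN (sqrt u))%nat <-> INR m ^ 2 <= u.
Proof.
  intros Hu. pose proof (floorN_bound (sqrt u) (sqrt_pos u)) as Hb.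
  pose proof (sqrt_sqrt u Hu) as Hs. pose proof (sqrt_pos u) as Hp.
  pose proof (pos_INR m) as Hm. split; intros H.
  - apply le_INR in H. nra.
  - apply Nat.lt_succ_r, INR_lt. nra.
Qed.

Lemma sum_n_m_cutoff (F : nat -> R) (P : nat -> Prop)
    (dec : forall m, {P m} + {~ P m}) (k n : nat) :
  (k <= n)%nat -> (forall m, (1 <= m)%nat -> (m <= k)%nat <-> P m) ->
  sum_n_m (fun m => if dec m then F m else 0) 1 n = sum_n_m F 1 k.
Proof.
  intros Hkn HP. rewrite (sum_n_m_Chasles _ 1 k n) by lia.
  rewrite (sum_n_m_ext_loc _ F 1 k).
  - rewrite (sum_n_m_ext_loc _ (fun _ => zero) (S k) n).
    + rewrite sum_n_m_const_zero. apply plus_zero_r.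
    + intros m Hm. destruct (dec m) as [H|H]; [|reflexivity].
      apply HP in H; lia.
  - intros m Hm. destruct (dec m) as [H|H]; [reflexivity|].
    exfalso. apply H, HP; lia.
Qed.

Lemma is_RInt_from_square (h : R -> R) (m : nat) (a b : R) :
  cellwise_continuous h -> 0 < a -> a < b -> INR m ^ 2 <= b ->
  is_RInt (fun u => if Rle_dec (INR m ^ 2) u then h u else 0) a b
    (RInt h (Rmax (INR m ^ 2) a) b).
Proof.
  intros Hh Ha Hab Hm. destruct (Rle_dec (INR m ^ 2) a) as [H|H].
  - rewrite Rmax_right by exact H.
    apply is_RInt_ext with h.
    { intros u. rewrite Rmin_left, Rmax_right by lra. intros Hu.
      destruct (Rle_dec (INR m ^ 2) u); lra. }
    apply (RInt_correct (V := R_CompleteNormedModule)).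
    apply ex_RInt_cellwise; auto; lra.
  - rewrite Rmax_left by lra.
    rewrite <- (Rplus_0_l (RInt h (INR m ^ 2) b)).
    apply (is_RInt_Chasles (V := R_NormedModule) _ a (INR m ^ 2) b).
    + apply is_RInt_ext with (fun _ => 0).
      { intros u. rewrite Rmin_left, Rmax_right by lra. intros Hu.
        destruct (Rle_dec (INR m ^ 2) u); lra. }
      apply is_RInt_0.
    + apply is_RInt_ext with h.
      { intros u. rewrite Rmin_left, Rmax_right by lra. intros Hu.
        destruct (Rle_dec (INR m ^ 2) u); lra. }
      apply (RInt_correct (V := R_CompleteNormedModule)).
      apply ex_RInt_cellwise; auto; lra.
Qed.

Lemma sum_Ioc_0 {G : AbelianMonoid} (F : nat -> G) (y : R) :
  sum_Ioc F 0 y = sum_n_m F 1 (floorN y).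
Proof.
  unfold sum_Ioc. replace (Zfloor 0) with 0%Z; [reflexivity|].
  symmetry. apply (ZfloorZ 0).
Qed.

(** The condition [m <= sqrt u] in [discrepancy u] is turned into [m ^ 2 <= u],
    so that the sum has a fixed range and can be integrated term by term; the
    [m]-th integral then starts at [max (m ^ 2) a]. *)
Lemma is_RInt_discrepancy (h : R -> R) (a b : R) :
  cellwise_continuous h -> 0 < a -> a < b ->
  is_RInt (fun u => discrepancy u * h u) a b
    (RInt (fun u => psi (sqrt u) ^ 2 * h u) a b
     + 2 * sum_Ioc (fun m => RInt (fun u => psi (u / INR m) * h u)
                               (Rmax (INR m ^ 2) a) b) 0 (sqrt b)).
Proof.
  intros Hh Ha Hab. rewrite (sum_Ioc_0 (G := R_AbelianMonoid)).
  apply is_RInt_ext with (fun u => plus (psi (sqrt u) ^ 2 * h u)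
    (scal 2 (sum_n_m (fun m => if Rle_dec (INR m ^ 2) u
                               then psi (u / INR m) * h u else 0)
               1 (floorN (sqrt b))))).
  { intros u. rewrite Rmin_left, Rmax_right by lra. intros Hu.
    rewrite (sum_n_m_cutoff (fun m => psi (u / INR m) * h u)
      (fun m => INR m ^ 2 <= u) (fun m => Rle_dec (INR m ^ 2) u) (floorN (sqrt u))).
    - unfold discrepancy, plus, scal, mult; simpl.
      rewrite (sum_n_m_ext _ (fun m => h u * psi (u / INR m)))
        by (intros; apply Rmult_comm).
      rewrite sum_n_m_Rmult. unfold mult; simpl. eq_in_R. ring.
    - apply le_floorN_sqrt; [lra|].
      apply Rle_trans with u; [|lra]. apply le_floorN_sqrt; [lra|]. lia.
    - intros m _. apply le_floorN_sqrt. lra. }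
  apply (is_RInt_plus (V := R_NormedModule)).
  - apply (RInt_correct (V := R_CompleteNormedModule)).
    apply ex_RInt_cellwise; [|lra|lra].
    apply cellwise_mult; [|exact Hh].
    apply cellwise_psi_sqrt_sqr.
  - apply (is_RInt_scal (V := R_NormedModule)).
    apply is_RInt_sum_n_m. intros m [Hm1 Hm2].
    apply is_RInt_from_square; auto.
    + apply cellwise_mult; [now apply cellwise_psi_div|exact Hh].
    + apply le_floorN_sqrt; [lra|exact Hm2].
Qed.

Lemma is_RInt_smooth_rate (h : R -> R) (a b : R) :
  cellwise_continuous h -> 0 < a -> a < b ->
  is_RInt (fun u => smooth_rate u * h u) a b
    (RInt (fun u => (ln u + 2 * euler_gamma) * h u) a b
     - 2 * RInt (fun u => h u * psi2 (sqrt u) / u) a b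
     - RInt (fun u => h u * psi (sqrt u) / sqrt u) a b
     + 4 * RInt (fun u => h u * psi2_tail (sqrt u)) a b).
Proof.
  intros Hh Ha Hab.
  assert (Hex : forall k, cellwise_continuous k -> is_RInt k a b (RInt k a b)).
  { intros k Hk. apply (RInt_correct (V := R_CompleteNormedModule)).
    apply ex_RInt_cellwise; auto; lra. }
  apply is_RInt_ext with (fun u => plus (minus (minus
      ((ln u + 2 * euler_gamma) * h u)
      (scal 2 (h u * psi2 (sqrt u) / u)))
      (h u * psi (sqrt u) / sqrt u))
      (scal 4 (h u * psi2_tail (sqrt u)))).
  { intros u. rewrite Rmin_left, Rmax_right by lra. intros Hu.
    rewrite (smooth_rate_expand u) by lra.
    unfold plus, minus, scal, opp, plus, mult; simpl. unfold mult; simpl.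
    pose proof (sqrt_lt_R0 u ltac:(lra)). field. lra. }
  apply (is_RInt_plus (V := R_NormedModule));
    [apply (is_RInt_minus (V := R_NormedModule));
      [apply (is_RInt_minus (V := R_NormedModule))|]|].
  - apply Hex. apply cellwise_mult; [apply cellwise_log_weight|exact Hh].
  - apply (is_RInt_scal (V := R_NormedModule)), Hex.
    apply cellwise_mult; [apply cellwise_mult|]; auto.
    + apply cellwise_psi2_sqrt.
    + apply cellwise_inv.
  - apply Hex. apply cellwise_mult; [apply cellwise_mult|]; auto.
    + apply cellwise_psi_sqrt.
    + apply cellwise_inv_sqrt.
  - apply (is_RInt_scal (V := R_NormedModule)), Hex.
    apply cellwise_mult; auto. apply cellwise_tail_sqrt.
Qed.

Lemma divisor_sum_formula_real (phi phi' : R -> R) (a b : R) :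
  (forall u, is_derive phi u (phi' u)) -> (forall u, continuous phi' u) ->
  0 < a -> a < b ->
  sum_Ioc (fun n => INR (num_divisors n) * phi (INR n)) a b =
  RInt (fun u => (ln u + 2 * euler_gamma) * phi u) a b
  - 2 * RInt (fun u => phi u * psi2 (sqrt u) / u) a b
  - RInt (fun u => phi u * psi (sqrt u) / sqrt u) a b
  + 4 * RInt (fun u => phi u * psi2_tail (sqrt u)) a b
  - phi b * psi (sqrt b) ^ 2
  + phi a * psi (sqrt a) ^ 2
  + RInt (fun u => psi (sqrt u) ^ 2 * phi' u) a b
  + 2 * phi a * sum_Ioc (fun m => psi (a / INR m)) 0 (sqrt a)
  - 2 * phi b * sum_Ioc (fun m => psi (b / INR m)) 0 (sqrt b)
  + 2 * sum_Ioc (fun m => RInt (fun u => psi (u / INR m) * phi' u)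
                            (Rmax (INR m ^ 2) a) b) 0 (sqrt b).
Proof.
  intros Hphi Hphi' Ha Hab.
  pose proof (is_RInt_divisor_sum phi phi' a b Hphi Hphi' Ha Hab) as H1.
  assert (C : cellwise_continuous phi).
  { apply cellwise_of_continuous. intros u _.
    apply (ex_derive_continuous (V := R_NormedModule)). now exists (phi' u). }
  assert (C' : cellwise_continuous phi').
  { apply cellwise_of_continuous. intros u _. apply Hphi'. }
  pose proof (is_RInt_plus (V := R_NormedModule) _ _ _ _ _ _
    (is_RInt_smooth_rate phi a b C Ha Hab)
    (is_RInt_discrepancy phi' a b C' Ha Hab)) as H2.
  apply (is_RInt_unique (V := R_CompleteNormedModule)) in H1, H2.
  pose proof (eq_trans (eq_sym H1) H2) as E. clear H1 H2.
  unfold discrepancy in E. unfold plus in E; simpl in E.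
  rewrite !(sum_Ioc_0 (G := R_AbelianMonoid)) in *. simpl in *. lra.
Qed.

(** * Absolute convergence of the Fourier terms *)

(** The phase [theta] lets one argument cover cosines ([theta = 0]) and sines
    ([theta = - PI / 2]). *)
Definition wave (theta : R) (k : nat) (u : R) : R :=
  cos (2 * PI * INR k * u + theta).

Lemma continuous_wave (theta : R) (k : nat) (u : R) :
  continuous (wave theta k) u.
Proof.
  apply (ex_derive_continuous (V := R_NormedModule)). unfold wave. now auto_derive.
Qed.

Lemma is_RInt_full_period (z : Z) (theta : R) (q : nat) : (z <> 0)%Z ->
  is_RInt (fun u => cos (2 * PI * IZR z * u + theta)) 0 (INR q) 0.
Proof.
  intros Hz. assert (Hz' : IZR z <> 0) by now apply not_0_IZR.
  pose proof PI_RGT_0 as Hpi.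
  assert (H : is_RInt (fun u => cos (2 * PI * IZR z * u + theta)) 0 (INR q)
    (minus (sin (2 * PI * IZR z * INR q + theta) / (2 * PI * IZR z))
           (sin (2 * PI * IZR z * 0 + theta) / (2 * PI * IZR z)))).
  { apply (is_RInt_derive (V := R_CompleteNormedModule)
      (fun u => sin (2 * PI * IZR z * u + theta) / (2 * PI * IZR z))).
    - intros u _. auto_derive; [trivial|]. field. lra.
    - intros u _. apply (ex_derive_continuous (V := R_NormedModule)).
      now auto_derive. }
  replace 0 with (minus (sin (2 * PI * IZR z * INR q + theta) / (2 * PI * IZR z))
           (sin (2 * PI * IZR z * 0 + theta) / (2 * PI * IZR z))) at 2; [exact H|].
  replace (sin (2 * PI * IZR z * INR q + theta)) with (sin (2 * PI * IZR z * 0 + theta)).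
  { unfold minus, plus, opp; simpl. ring. }
  rewrite Rmult_0_r, Rplus_0_l. rewrite INR_IZR_INZ.
  destruct (Z_le_gt_dec 0 (z * Z.of_nat q)) as [H0|H0].
  - rewrite <- (sin_period theta (Z.to_nat (z * Z.of_nat q))).
    f_equal. rewrite INR_IZR_INZ, Z2Nat.id by lia. rewrite mult_IZR. ring.
  - rewrite <- (sin_period (2 * PI * IZR z * IZR (Z.of_nat q) + theta)
      (Z.to_nat (- (z * Z.of_nat q)))).
    f_equal. rewrite INR_IZR_INZ, Z2Nat.id by lia. rewrite opp_IZR, mult_IZR. ring.
Qed.

Lemma wave_mult (theta : R) (j k : nat) (u : R) :
  wave theta j u * wave theta k u =
  1 / 2 * cos (2 * PI * IZR (Z.of_nat j - Z.of_nat k) * u + 0)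
  + 1 / 2 * cos (2 * PI * IZR (Z.of_nat j + Z.of_nat k) * u + 2 * theta).
Proof.
  unfold wave. rewrite minus_IZR, plus_IZR, <- !INR_IZR_INZ.
  replace (2 * PI * (INR j - INR k) * u + 0)
    with ((2 * PI * INR j * u + theta) - (2 * PI * INR k * u + theta)) by ring.
  replace (2 * PI * (INR j + INR k) * u + 2 * theta)
    with ((2 * PI * INR j * u + theta) + (2 * PI * INR k * u + theta)) by ring.
  generalize (2 * PI * INR j * u + theta), (2 * PI * INR k * u + theta).
  intros x y. rewrite cos_minus, cos_plus. field.
Qed.

Lemma is_RInt_wave_mult (theta : R) (j k q : nat) : (1 <= j)%nat -> (1 <= k)%nat ->
  is_RInt (fun u => wave theta j u * wave theta k u) 0 (INR q)
    (if Nat.eq_dec j k then INR q / 2 else 0).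
Proof.
  intros Hj Hk.
  eapply is_RInt_ext; [intros u _; symmetry; apply wave_mult|].
  destruct (Nat.eq_dec j k) as [<-|Hjk].
  - replace (INR q / 2) with (1 / 2 * INR q + 1 / 2 * 0) by field.
    apply is_RInt_Rplus; apply is_RInt_Rmult.
    + apply is_RInt_ext with (fun _ => 1).
      { intros u _. rewrite Z.sub_diag. rewrite Rmult_0_r, Rmult_0_l, Rplus_0_l.
        now rewrite cos_0. }
      pose proof (is_RInt_const (V := R_NormedModule) 0 (INR q) 1) as H.
      unfold scal in H; simpl in H. unfold mult in H; simpl in H.
      replace ((INR q - 0) * 1) with (INR q) in H by ring. exact H.
    + apply is_RInt_full_period. lia.
  - replace 0 with (1 / 2 * 0 + 1 / 2 * 0) at 2 by ring.
    apply is_RInt_Rplus; apply is_RInt_Rmult; apply is_RInt_full_period; lia.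
Qed.

Definition trig_poly (theta : R) (w : nat -> R) (N : nat) (u : R) : R :=
  sum_n_m (fun k => w k * wave theta k u) 1 N.

Lemma trig_poly_S (theta : R) (w : nat -> R) (N : nat) (u : R) :
  trig_poly theta w (S N) u = trig_poly theta w N u + w (S N) * wave theta (S N) u.
Proof. unfold trig_poly. rewrite sum_n_Sm by lia. reflexivity. Qed.

Lemma continuous_trig_poly (theta : R) (w : nat -> R) (N : nat) (u : R) :
  continuous (trig_poly theta w N) u.
Proof.
  induction N as [|N IH].
  - apply continuous_ext with (fun _ => 0); [|apply continuous_const].
    intros v. unfold trig_poly. now rewrite sum_n_m_zero by lia.
  - apply continuous_ext
      with (fun v => trig_poly theta w N v + w (S N) * wave theta (S N) v).
    { intros v. now rewrite trig_poly_S. }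
    apply (continuous_plus (V := R_NormedModule)); [exact IH|].
    apply (continuous_mult (K := R_AbsRing)); [apply continuous_const|].
    apply continuous_wave.
Qed.

Lemma is_RInt_trig_poly_sqr (theta : R) (w : nat -> R) (N q : nat) :
  is_RInt (fun u => trig_poly theta w N u * trig_poly theta w N u) 0 (INR q)
    (INR q / 2 * sum_n_m (fun k => w k ^ 2) 1 N).
Proof.
  induction N as [|N IH].
  - rewrite sum_n_m_zero by lia. change (@zero R_AbelianMonoid) with 0.
    rewrite Rmult_0_r. apply is_RInt_ext with (fun _ => 0); [|apply is_RInt_0].
    intros u _. unfold trig_poly. rewrite sum_n_m_zero by lia.
    change (@zero R_AbelianMonoid) with 0. now rewrite Rmult_0_r.
  - apply is_RInt_ext with (fun u =>
      trig_poly theta w N u * trig_poly theta w N u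
      + (2 * w (S N) * sum_n_m (fun k => w k * (wave theta k u * wave theta (S N) u)) 1 N
         + w (S N) ^ 2 * (wave theta (S N) u * wave theta (S N) u))).
    { intros u _. rewrite trig_poly_S.
      rewrite (sum_n_m_ext _ (fun k => wave theta (S N) u * (w k * wave theta k u)))
        by (intros; eq_in_R; ring).
      rewrite sum_n_m_Rmult. fold (trig_poly theta w N u). eq_in_R. ring. }
    rewrite sum_n_Sm by lia. change plus with Rplus.
    replace (INR q / 2 * (sum_n_m (fun k => w k ^ 2) 1 N + w (S N) ^ 2))
      with (INR q / 2 * sum_n_m (fun k => w k ^ 2) 1 N
            + (2 * w (S N) * 0 + w (S N) ^ 2 * (INR q / 2))) by ring.
    apply is_RInt_Rplus; [exact IH|].
    apply is_RInt_Rplus; apply is_RInt_Rmult.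
    + replace 0 with (sum_n_m (fun _ : nat => 0) 1 N) at 2
        by apply (sum_n_m_const_zero (G := R_AbelianMonoid)).
      apply is_RInt_sum_n_m. intros k Hk.
      replace 0 with (w k * 0) at 2 by ring. apply is_RInt_Rmult.
      pose proof (is_RInt_wave_mult theta k (S N) q ltac:(lia) ltac:(lia)) as H.
      destruct (Nat.eq_dec k (S N)); [lia|exact H].
    + pose proof (is_RInt_wave_mult theta (S N) (S N) q ltac:(lia) ltac:(lia)) as H.
      destruct (Nat.eq_dec (S N) (S N)); [exact H|lia].
Qed.

Lemma sum_inv_sqr_le (N : nat) : sum_n_m (fun k => (/ INR k) ^ 2) 1 N <= 2.
Proof.
  destruct N as [|N].
  { rewrite sum_n_m_zero by lia. change (@zero R_AbelianMonoid) with 0. lra. }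
  (* Telescoping: [1 / k ^ 2 <= 1 / (k - 1) - 1 / k]. *)
  assert (H : sum_n_m (fun k => (/ INR k) ^ 2) 1 (S N) <= 2 - / INR (S N)).
  { induction N as [|N IH].
    - rewrite sum_n_n. simpl. lra.
    - rewrite sum_n_Sm by lia. change plus with Rplus.
      assert (Hp : 0 < INR (S N)) by (apply lt_0_INR; lia).
      assert (E : / INR (S N) - / INR (S (S N)) - (/ INR (S (S N))) ^ 2
                  = / (INR (S N) * INR (S (S N)) ^ 2)).
      { rewrite (S_INR (S N)). field. lra. }
      assert (0 < / (INR (S N) * INR (S (S N)) ^ 2)).
      { apply Rinv_0_lt_compat, Rmult_lt_0_compat; [exact Hp|].
        apply pow_lt, lt_0_INR; lia. }
      lra. }
  assert (0 < / INR (S N)) by (apply Rinv_0_lt_compat, lt_0_INR; lia). lra.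
Qed.

Lemma RInt_nonneg_mono (h : R -> R) (a b c d : R) :
  (forall u, continuous h u) -> (forall u, 0 <= h u) ->
  a <= c -> c <= d -> d <= b -> RInt h c d <= RInt h a b.
Proof.
  intros Hc Hp Hac Hcd Hdb.
  assert (E : RInt h a b = RInt h a c + RInt h c d + RInt h d b).
  { rewrite <- (RInt_Chasles (V := R_CompleteNormedModule) h a d b),
      <- (RInt_Chasles (V := R_CompleteNormedModule) h a c d)
      by (apply ex_RInt_cont, Hc). reflexivity. }
  pose proof (RInt_ge_0 h a c Hac (ex_RInt_cont h a c Hc) (fun u _ => Hp u)).
  pose proof (RInt_ge_0 h d b Hdb (ex_RInt_cont h d b Hc) (fun u _ => Hp u)).
  lra.
Qed.

(** A Bessel-type estimate that avoids orthonormal expansions. With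
    [w k = (sign of the k-th coefficient) / k] and [T] the trigonometric
    polynomial with coefficients [w], the sum is the integral of [g * T], which is
    at most half the integral of [g ^ 2 + T ^ 2]; by orthogonality over whole
    periods the integral of [T ^ 2] stays bounded because [1 / k ^ 2] is
    summable. *)
Lemma fourier_coeff_sum_bounded (g : R -> R) (theta c d : R) :
  (forall u, continuous g u) -> 0 <= c -> c <= d ->
  exists M, forall N,
    sum_n_m (fun k => / INR k * Rabs (RInt (fun u => g u * wave theta k u) c d)) 1 N
    <= M.
Proof.
  intros Hg Hc Hcd. set (q := S (floorN d)).
  assert (Hq : d <= INR q) by (left; apply floorN_bound; lra).
  (* [INR q / 2 * 2] bounds the integral of [T ^ 2] over [q] periods. *)
  exists (1 / 2 * RInt (fun u => g u * g u) c d + 1 / 2 * INR q).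
  intros N. set (I := fun k => RInt (fun u => g u * wave theta k u) c d).
  set (w := fun k => (if Rle_dec 0 (I k) then 1 else -1) * / INR k).
  set (T := trig_poly theta w N).
  assert (HT : forall u, continuous T u) by apply continuous_trig_poly.
  assert (Hsum : is_RInt (fun u => g u * T u) c d (sum_n_m (fun k => w k * I k) 1 N)).
  { apply is_RInt_ext
      with (fun u => sum_n_m (fun k => w k * (g u * wave theta k u)) 1 N).
    { intros u _. unfold T, trig_poly. rewrite <- sum_n_m_Rmult.
      apply sum_n_m_ext. intros k. eq_in_R. ring. }
    apply is_RInt_sum_n_m. intros k _. apply is_RInt_Rmult.
    apply is_RInt_cont. intros u. apply continuous_Rmult; [apply Hg|].
    apply continuous_wave. }
  rewrite (sum_n_m_ext _ (fun k => w k * I k)).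
  2:{ intros k. fold (I k). unfold w. eq_in_R. destruct (Rle_dec 0 (I k)).
      - rewrite Rabs_pos_eq by assumption. ring.
      - rewrite Rabs_left by lra. ring. }
  apply (is_RInt_unique (V := R_CompleteNormedModule)) in Hsum.
  rewrite <- Hsum.
  assert (Hle : RInt (fun u => g u * T u) c d
    <= 1 / 2 * RInt (fun u => g u * g u) c d + 1 / 2 * RInt (fun u => T u * T u) c d).
  { pose proof (is_RInt_Rplus _ _ _ _ _ _
      (is_RInt_Rmult _ (1 / 2) _ _ _
         (is_RInt_cont (fun u => g u * g u) c d
            (fun u => continuous_Rmult g g u (Hg u) (Hg u))))
      (is_RInt_Rmult _ (1 / 2) _ _ _
         (is_RInt_cont (fun u => T u * T u) c d
            (fun u => continuous_Rmult T T u (HT u) (HT u))))) as H.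
    rewrite <- (is_RInt_unique (V := R_CompleteNormedModule) _ _ _ _ H).
    apply RInt_le; [exact Hcd| |eexists; exact H|].
    - apply ex_RInt_cont. intros u. now apply continuous_Rmult.
    - intros u _. pose proof (pow2_ge_0 (g u - T u)). lra. }
  assert (HTT : RInt (fun u => T u * T u) c d <= RInt (fun u => T u * T u) 0 (INR q)).
  { apply RInt_nonneg_mono; auto.
    - intros u. now apply continuous_Rmult.
    - intros u. apply Rle_0_sqr. }
  unfold T in HTT at 3 4.
  rewrite (is_RInt_unique (V := R_CompleteNormedModule) _ _ _ _
    (is_RInt_trig_poly_sqr theta w N q)) in HTT.
  assert (Hw : sum_n_m (fun k => w k ^ 2) 1 N <= 2).
  { rewrite (sum_n_m_ext _ (fun k => (/ INR k) ^ 2)); [apply sum_inv_sqr_le|].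
    intros k. unfold w. eq_in_R. destruct (Rle_dec 0 (I k)); ring. }
  pose proof (pos_INR q). nra.
Qed.

(** * Fourier partial sums of the sawtooth *)

Definition sine_sum (N : nat) (u : R) : R :=
  sum_n_m (fun k => / INR k * sin (2 * PI * INR k * u)) 1 N.

Lemma sine_sum_S (N : nat) (u : R) :
  sine_sum (S N) u = sine_sum N u + / INR (S N) * sin (2 * PI * INR (S N) * u).
Proof. unfold sine_sum. rewrite sum_n_Sm by lia. reflexivity. Qed.

Lemma sine_sum_0 (u : R) : sine_sum 0 u = 0.
Proof. unfold sine_sum. now rewrite sum_n_m_zero by lia. Qed.

Definition dirichlet_kernel (N : nat) (u : R) : R :=
  1 + 2 * sum_n_m (fun k => cos (2 * PI * INR k * u)) 1 N.

Lemma dirichlet_kernel_S (N : nat) (u : R) : dirichlet_kernel (S N) u =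
  dirichlet_kernel N u + 2 * cos (2 * PI * INR (S N) * u).
Proof.
  unfold dirichlet_kernel. rewrite sum_n_Sm by lia. change plus with Rplus. ring.
Qed.

Lemma dirichlet_kernel_sin (N : nat) (u : R) :
  dirichlet_kernel N u * sin (PI * u) = sin ((2 * INR N + 1) * PI * u).
Proof.
  induction N as [|N IH].
  - unfold dirichlet_kernel. rewrite sum_n_m_zero by lia.
    change (@zero R_AbelianMonoid) with 0. simpl.
    replace ((2 * 0 + 1) * PI * u) with (PI * u) by ring. ring.
  - rewrite dirichlet_kernel_S, Rmult_plus_distr_r, IH, S_INR.
    replace ((2 * INR N + 1) * PI * u)
      with (2 * PI * (INR N + 1) * u - PI * u) by ring.
    replace ((2 * (INR N + 1) + 1) * PI * u)
      with (2 * PI * (INR N + 1) * u + PI * u) by ring.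
    generalize (2 * PI * (INR N + 1) * u), (PI * u). intros x y.
    rewrite sin_minus, sin_plus. ring.
Qed.

(** The error of the [N]-th Fourier partial sum of the sawtooth [psi] on the
    open interval [(0, 1)]. *)
Definition sawtooth_error (N : nat) (u : R) : R := u - 1 / 2 + / PI * sine_sum N u.

Lemma is_derive_sawtooth_error (N : nat) (u : R) :
  is_derive (sawtooth_error N) u (dirichlet_kernel N u).
Proof.
  pose proof PI_RGT_0 as Hpi. induction N as [|N IH].
  - apply is_derive_ext with (fun v => v - 1 / 2).
    { intros v. unfold sawtooth_error. rewrite sine_sum_0. eq_in_R. ring. }
    unfold dirichlet_kernel. rewrite sum_n_m_zero by lia.
    change (@zero R_AbelianMonoid) with 0. auto_derive; [trivial|ring].
  - rewrite dirichlet_kernel_S.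
    assert (Hn : 0 < INR (S N)) by (apply lt_0_INR; lia).
    apply is_derive_ext with (fun v => plus (sawtooth_error N v)
      (/ PI * (/ INR (S N) * sin (2 * PI * INR (S N) * v)))).
    { intros v. unfold sawtooth_error. rewrite sine_sum_S.
      unfold plus; simpl. eq_in_R. ring. }
    apply (is_derive_plus (V := R_NormedModule)); [exact IH|].
    revert Hn. generalize (INR (S N)). intros r Hr.
    auto_derive; [trivial|]. field. lra.
Qed.

(** From [x - x ^ 3 / 6 <= sin x] with [3 u <= x = PI u <= 2]. *)
Lemma sin_PI_lower (u : R) : 0 < u <= 1 / 2 -> u <= sin (PI * u).
Proof.
  intros Hu. pose proof PI2_3_2 as H3. pose proof PI_4 as H4.
  pose proof (pre_sin_bound (PI * u) 0 ltac:(nra) ltac:(nra)) as [H _].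
  unfold sin_approx, sin_term in H. simpl in H.
  set (x := PI * u) in *. assert (Hx : 0 < x <= 2) by (unfold x; nra).
  assert (H' : x - x ^ 3 / 6 <= sin x).
  { eapply Rle_trans; [|exact H]. simpl. lra. }
  assert (3 * u <= x) by (unfold x; nra).
  assert (x * x <= 4) by nra. nra.
Qed.

Lemma sawtooth_error_half (N : nat) : sawtooth_error N (1 / 2) = 0.
Proof.
  unfold sawtooth_error. replace (sine_sum N (1 / 2)) with 0; [field; apply PI_neq0|].
  induction N as [|N IH]; [now rewrite sine_sum_0|].
  rewrite sine_sum_S, <- IH.
  rewrite (sin_eq_0_1 (2 * PI * INR (S N) * (1 / 2))); [ring|].
  exists (Z.of_nat (S N)). rewrite <- INR_IZR_INZ. field.
Qed.

Lemma cos_odd_half (N : nat) : cos ((2 * INR N + 1) * PI * (1 / 2)) = 0.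
Proof.
  apply cos_eq_0_1. exists (Z.of_nat N). rewrite <- INR_IZR_INZ. field.
Qed.

(** The derivative of the error is the Dirichlet kernel [sin (A u) / sin (PI u)],
    [A = (2 N + 1) PI], and the error vanishes at [1 / 2]. One integration by parts
    of the kernel gives the boundary term [- cos (A u) / (A sin (PI u))] and a
    remainder whose derivative is at most that of [- 1 / (A sin (PI u))] in
    absolute value; comparing monotone functions avoids the integral. *)
Lemma sawtooth_error_far (N : nat) (u : R) : 0 < u <= 1 / 2 ->
  Rabs (sawtooth_error N u) <= 2 / ((2 * INR N + 1) * PI * u).
Proof.
  intros Hu. pose proof PI_RGT_0 as Hpi. pose proof (pos_INR N) as HN.
  set (A := (2 * INR N + 1) * PI). assert (HA : 0 < A) by (unfold A; nra).
  assert (Hs : forall v, u <= v <= 1 / 2 -> 0 < sin (PI * v)).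
  { intros v Hv. pose proof (sin_PI_lower v ltac:(lra)). lra. }
  (* Both signs [s = 1] and [s = -1] bound the error plus its boundary term. *)
  assert (Hmono : forall s, -1 <= s <= 1 ->
    s * (sawtooth_error N u + cos (A * u) / (A * sin (PI * u)))
    <= / (A * sin (PI * u))).
  { intros s Hs1.
    set (F := fun v => s * (sawtooth_error N v + cos (A * v) / (A * sin (PI * v)))
                       - / (A * sin (PI * v))).
    set (F' := fun v => PI * cos (PI * v) * (1 - s * cos (A * v))
                        / (A * sin (PI * v) ^ 2)).
    assert (HF : forall v, u <= v <= 1 / 2 -> is_derive F v (F' v)).
    { intros v Hv. specialize (Hs v Hv). unfold F, F'.
      pose proof (is_derive_sawtooth_error N v) as HR.
      pose proof (dirichlet_kernel_sin N v) as HD. fold A in HD.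
      auto_derive.
      - repeat split; try (apply Rgt_not_eq; nra). now exists (dirichlet_kernel N v).
      - replace (Derive (fun x : R => sawtooth_error N x) v)
          with (dirichlet_kernel N v)
          by (symmetry; apply is_derive_unique, HR).
        replace (dirichlet_kernel N v) with (sin (A * v) / sin (PI * v))
          by (rewrite <- HD; field; lra).
        field. lra. }
    assert (H : F u <= F (1 / 2)).
    { destruct (proj2 Hu) as [Hlt| ->]; [|lra].
      destruct (MVT_gen F u (1 / 2) F') as [v [Hv E]].
      - intros v. rewrite Rmin_left, Rmax_right by lra. intros Hv. apply HF. lra.
      - intros v. rewrite Rmin_left, Rmax_right by lra. intros Hv.
        apply continuity_pt_filterlim.
        apply (ex_derive_continuous (V := R_NormedModule)).
        exists (F' v). now apply HF.
      - rewrite Rmin_left, Rmax_right in Hv by lra.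
        assert (0 <= F' v).
        { unfold F'. specialize (Hs v Hv).
          assert (0 <= cos (PI * v)) by (apply cos_ge_0; nra).
          pose proof (COS_bound (A * v)).
          apply Rle_mult_inv_pos; [|apply Rmult_lt_0_compat; nra].
          apply Rmult_le_pos; [nra|]. nra. }
        nra. }
    unfold F in H. rewrite sawtooth_error_half in H.
    rewrite (cos_odd_half N : cos (A * (1 / 2)) = 0) in H.
    specialize (Hs (1 / 2) ltac:(lra)).
    assert (0 < / (A * sin (PI * (1 / 2)))).
    { apply Rinv_0_lt_compat, Rmult_lt_0_compat; lra. }
    unfold Rdiv in *. rewrite Rmult_0_l in H. lra. }
  specialize (Hs u ltac:(lra)).
  assert (Hi : / (A * sin (PI * u)) <= / (A * u)).
  { apply Rinv_le_contravar; [nra|]. pose proof (sin_PI_lower u Hu). nra. }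
  assert (Hi0 : 0 < / (A * sin (PI * u))).
  { apply Rinv_0_lt_compat, Rmult_lt_0_compat; lra. }
  assert (Hc : Rabs (cos (A * u) / (A * sin (PI * u))) <= / (A * sin (PI * u))).
  { unfold Rdiv. rewrite Rabs_mult, (Rabs_pos_eq (/ _)) by lra.
    assert (Rabs (cos (A * u)) <= 1) by (apply Rabs_le, COS_bound).
    nra. }
  apply Rabs_le_between in Hc.
  pose proof (Hmono 1 ltac:(lra)). pose proof (Hmono (-1) ltac:(lra)).
  unfold Rdiv at 1. apply Rabs_le. lra.
Qed.

(** Each term is at most [2 PI u], which serves where [N u <= 1] and the bound of
    [sawtooth_error_far] is too large. *)
Lemma sine_sum_near (N : nat) (u : R) : 0 < u ->
  Rabs (sine_sum N u) <= 2 * PI * INR N * u.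
Proof.
  intros Hu. pose proof PI_RGT_0 as Hpi. induction N as [|N IH].
  - rewrite sine_sum_0, Rabs_R0. simpl. lra.
  - rewrite sine_sum_S.
    assert (Hn : 0 < INR (S N)) by (apply lt_0_INR; lia).
    eapply Rle_trans; [apply Rabs_triang|].
    rewrite Rabs_mult, (Rabs_pos_eq (/ _)) by (left; now apply Rinv_0_lt_compat).
    assert (Hx : 0 < 2 * PI * INR (S N) * u) by (repeat first [lra | apply Rmult_lt_0_compat]).
    assert (Hsin : Rabs (sin (2 * PI * INR (S N) * u)) <= 2 * PI * INR (S N) * u).
    { pose proof (sin_lt_x _ Hx).
      destruct (Rle_dec 0 (sin (2 * PI * INR (S N) * u))) as [H0|H0].
      - rewrite Rabs_pos_eq; lra.
      - rewrite Rabs_left by lra. rewrite <- sin_neg.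
        set (x := 2 * PI * INR (S N) * u) in *.
        destruct (Rle_dec x 1) as [H1|H1].
        + exfalso. apply H0. left. apply sin_gt_0; [lra|]. pose proof PI2_3_2. lra.
        + pose proof (SIN_bound (- x)). lra. }
    assert (/ INR (S N) * Rabs (sin (2 * PI * INR (S N) * u))
            <= / INR (S N) * (2 * PI * INR (S N) * u)).
    { apply Rmult_le_compat_l; [left; now apply Rinv_0_lt_compat|exact Hsin]. }
    replace (/ INR (S N) * (2 * PI * INR (S N) * u)) with (2 * PI * u) in H
      by (field; lra).
    set (t := / INR (S N) * Rabs _) in *. rewrite S_INR. lra.
Qed.

Lemma sawtooth_error_left (N : nat) (u : R) : 0 < u <= 1 / 2 ->
  Rabs (sawtooth_error N u) <= 5 / (1 + INR N * u).
Proof.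
  intros Hu. pose proof PI_RGT_0 as Hpi. pose proof (pos_INR N) as HN.
  pose proof PI2_3_2 as H3.
  assert (HNu : 0 <= INR N * u) by nra.
  destruct (Rle_dec (INR N * u) 1) as [H|H].
  - apply Rle_trans with (5 / 2).
    + unfold sawtooth_error. eapply Rle_trans; [apply Rabs_triang|].
      rewrite Rabs_mult, (Rabs_pos_eq (/ _)) by (left; now apply Rinv_0_lt_compat).
      assert (Rabs (u - 1 / 2) <= 1 / 2) by (apply Rabs_le; lra).
      assert (/ PI * Rabs (sine_sum N u) <= / PI * (2 * PI * INR N * u)).
      { apply Rmult_le_compat_l; [left; now apply Rinv_0_lt_compat|].
        now apply sine_sum_near. }
      replace (/ PI * (2 * PI * INR N * u)) with (2 * (INR N * u)) in H1
        by (field; lra).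
      lra.
    + unfold Rdiv. apply Rmult_le_compat_l; [lra|].
      apply Rinv_le_contravar; lra.
  - eapply Rle_trans; [now apply sawtooth_error_far|].
    apply Rmult_le_reg_r with ((2 * INR N + 1) * PI * u).
    { repeat first [lra | apply Rmult_lt_0_compat]. }
    apply Rmult_le_reg_r with (1 + INR N * u); [lra|].
    field_simplify; [|lra|].
    2:{ split; [lra|]. split; lra. }
    nra.
Qed.

Lemma sin_reflect (k : nat) (u : R) :
  sin (2 * PI * INR k * (1 - u)) = - sin (2 * PI * INR k * u).
Proof.
  rewrite <- sin_neg, <- (sin_period (- (2 * PI * INR k * u)) k). f_equal. ring.
Qed.

Lemma sawtooth_error_reflect (N : nat) (u : R) :
  sawtooth_error N (1 - u) = - sawtooth_error N u.
Proof.
  assert (H : sine_sum N (1 - u) = - sine_sum N u).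
  { induction N as [|N IH]; [rewrite !sine_sum_0; ring|].
    rewrite !sine_sum_S, IH, sin_reflect. ring. }
  unfold sawtooth_error. rewrite H. field. apply PI_neq0.
Qed.

Lemma sawtooth_error_bound (N : nat) (u : R) : 0 < u < 1 ->
  Rabs (sawtooth_error N u) <= 5 / (1 + INR N * u) + 5 / (1 + INR N * (1 - u)).
Proof.
  intros Hu. pose proof (pos_INR N) as HN.
  assert (0 < 5 / (1 + INR N * u)) by (apply Rdiv_lt_0_compat; nra).
  assert (0 < 5 / (1 + INR N * (1 - u))) by (apply Rdiv_lt_0_compat; nra).
  destruct (Rle_dec u (1 / 2)) as [H1|H1].
  - pose proof (sawtooth_error_left N u ltac:(lra)). lra.
  - pose proof (sawtooth_error_left N (1 - u) ltac:(lra)) as H2.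
    rewrite sawtooth_error_reflect, Rabs_Ropp in H2. lra.
Qed.

(** * Integrating the sawtooth series term by term *)

Lemma continuous_sine_sum (N : nat) (u : R) : continuous (sine_sum N) u.
Proof.
  apply continuous_ext with (fun v => PI * (sawtooth_error N v - v + 1 / 2)).
  { intros v. unfold sawtooth_error. eq_in_R. field. apply PI_neq0. }
  assert (Hd : ex_derive (sawtooth_error N) u).
  { exists (dirichlet_kernel N u). apply is_derive_sawtooth_error. }
  apply (ex_derive_continuous (V := R_NormedModule)). now auto_derive.
Qed.

Lemma cellwise_psi : cellwise_continuous psi.
Proof.
  apply cellwise_ext with (fun u => psi (u / INR 1)).
  { intros u _. f_equal. simpl. field. }
  apply cellwise_psi_div. lia.
Qed.

Lemma sine_sum_shift (N n : nat) (u : R) : sine_sum N (u - INR n) = sine_sum N u.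
Proof.
  unfold sine_sum. apply sum_n_m_ext. intros k. eq_in_R. f_equal.
  rewrite <- (sin_period _ (k * n)). rewrite mult_INR. f_equal. ring.
Qed.

Lemma sawtooth_error_cell (N n : nat) (u : R) : INR n < u < INR (S n) ->
  psi u + / PI * sine_sum N u = sawtooth_error N (u - INR n).
Proof.
  intros Hu. pose proof (pos_INR n). unfold sawtooth_error.
  rewrite sine_sum_shift, psi_floorN, (floorN_eq n u) by lra. ring.
Qed.

Lemma is_lim_seq_ln_over : is_lim_seq (fun N => ln (1 + INR N) / (1 + INR N)) 0.
Proof.
  apply is_lim_seq_ext with (fun N => ln (INR (S N)) / INR (S N)).
  { intros N. now rewrite S_INR, Rplus_comm. }
  apply (is_lim_comp_seq (fun y => ln y / y) (fun N => INR (S N)) p_infty 0).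
  - apply is_lim_div_ln_p.
  - exists 0%nat. intros; discriminate.
  - apply is_lim_seq_incr_1 with (u := INR). apply is_lim_seq_INR.
Qed.

Lemma ex_RInt_sawtooth_error (g : R -> R) (N : nat) (x y : R) :
  (forall u, continuous g u) -> 0 < x -> x <= y ->
  ex_RInt (fun u => (psi u + / PI * sine_sum N u) * g u) x y.
Proof.
  intros Hg Hx Hxy. apply ex_RInt_cellwise; [|lra|lra]. apply cellwise_mult.
  - apply cellwise_plus; [apply cellwise_psi|].
    apply cellwise_of_continuous. intros u _.
    apply continuous_Rmult; [apply continuous_const|apply continuous_sine_sum].
  - apply cellwise_of_continuous. intros u _. apply Hg.
Qed.

(** The dominating function has logarithms as primitives, so the integral over a
    cell is [O (ln N / N)]. *)
Lemma sawtooth_error_integral (g : R -> R) (N n : nat) (x y M : R) :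
  (forall u, continuous g u) -> (1 <= N)%nat -> 0 < x ->
  INR n <= x -> x < y -> y <= INR (S n) ->
  (forall u, x <= u <= y -> Rabs (g u) <= M) ->
  Rabs (RInt (fun u => (psi u + / PI * sine_sum N u) * g u) x y)
  <= 20 * M * (ln (1 + INR N) / (1 + INR N)).
Proof.
  intros Hg HN Hx0 Hx Hxy Hy HM.
  assert (HN1 : 1 <= INR N) by (change 1 with (INR 1); now apply le_INR).
  rewrite S_INR in Hy.
  assert (HM0 : 0 <= M).
  { eapply Rle_trans; [apply Rabs_pos|apply (HM x); lra]. }
  set (h := fun u => 5 / (1 + INR N * (u - INR n))
                     + 5 / (1 + INR N * (1 - (u - INR n)))).
  (* A primitive of [h]. *)
  set (H := fun u => 5 / INR N * (ln (1 + INR N * (u - INR n))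
                     - ln (1 + INR N * (1 - (u - INR n))))).
  assert (Hh : is_RInt (fun u => M * h u) x y (M * (H y - H x))).
  { apply is_RInt_Rmult. apply (is_RInt_derive (V := R_CompleteNormedModule) H).
    - intros u. rewrite Rmin_left, Rmax_right by lra. intros Hu.
      assert (0 < 1 + INR N * (u - INR n)) by nra.
      assert (0 < 1 + INR N * (1 - (u - INR n))) by nra.
      unfold H, h. auto_derive; [lra|]. field. lra.
    - intros u. rewrite Rmin_left, Rmax_right by lra. intros Hu.
      assert (0 < 1 + INR N * (u - INR n)) by nra.
      assert (0 < 1 + INR N * (1 - (u - INR n))) by nra.
      apply (ex_derive_continuous (V := R_NormedModule)).
      unfold h. auto_derive. lra. }
  assert (Hex : ex_RInt (fun u => (psi u + / PI * sine_sum N u) * g u) x y).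
  { apply ex_RInt_sawtooth_error; auto; lra. }
  eapply Rle_trans; [apply abs_RInt_le; [lra|exact Hex]|].
  apply Rle_trans with (RInt (fun u => M * h u) x y).
  { apply RInt_le; [lra| |eexists; exact Hh|].
    - exact (ex_RInt_norm _ _ _ Hex).
    - intros u Hu. rewrite Rabs_mult.
      rewrite (sawtooth_error_cell N n) by (rewrite S_INR; lra).
      rewrite (Rmult_comm M). apply Rmult_le_compat; try apply Rabs_pos.
      + apply sawtooth_error_bound. lra.
      + apply HM. lra. }
  rewrite (is_RInt_unique (V := R_CompleteNormedModule) _ _ _ _ Hh).
  assert (Hln : forall t, 0 <= t <= 1 -> 0 <= ln (1 + INR N * t) <= ln (1 + INR N)).
  { intros t Ht. split.
    - rewrite <- ln_1. apply ln_le; nra.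
    - apply ln_le; nra. }
  pose proof (Hln (y - INR n) ltac:(lra)). pose proof (Hln (x - INR n) ltac:(lra)).
  pose proof (Hln (1 - (y - INR n)) ltac:(lra)).
  pose proof (Hln (1 - (x - INR n)) ltac:(lra)).
  assert (HL : 0 <= ln (1 + INR N)) by lra.
  assert (HH : H y - H x <= 5 / INR N * (2 * ln (1 + INR N))).
  { unfold H. rewrite <- Rmult_minus_distr_l. apply Rmult_le_compat_l; [|lra].
    apply Rle_mult_inv_pos; lra. }
  assert (HI : / INR N <= 2 * / (1 + INR N)).
  { apply Rmult_le_reg_l with (INR N * (1 + INR N)); [nra|].
    field_simplify; lra. }
  assert (HT : 5 / INR N * (2 * ln (1 + INR N))
               <= 20 * (ln (1 + INR N) / (1 + INR N))).
  { unfold Rdiv. nra. }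
  nra.
Qed.

Lemma sawtooth_error_lim (g : R -> R) (x y : R) :
  (forall u, continuous g u) -> 0 < x -> x < y ->
  is_lim_seq
    (fun N => RInt (fun u => (psi u + / PI * sine_sum N u) * g u) x y) 0.
Proof.
  intros Hg Hx Hxy. pose proof (Rlt_le _ _ Hx) as Hx0. revert Hx. pattern x, y.
  apply cell_ind; [| |exact Hx0|exact Hxy]; clear x y Hxy Hx0.
  - intros x y z _ Hxy Hyz H1 H2 Hx.
    specialize (H1 Hx). specialize (H2 ltac:(lra)).
    pose proof (is_lim_seq_plus' _ _ _ _ H1 H2) as H. rewrite Rplus_0_l in H.
    eapply is_lim_seq_ext; [|exact H]. intros N. cbv beta.
    pose proof (ex_RInt_sawtooth_error g N x y Hg Hx ltac:(lra)) as E1.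
    pose proof (ex_RInt_sawtooth_error g N y z Hg ltac:(lra) ltac:(lra)) as E2.
    exact (RInt_Chasles (V := R_CompleteNormedModule) _ x y z E1 E2).
  - intros n x y Hx Hxy Hy Hx0.
    destruct (continuity_ab_maj (fun u => Rabs (g u)) x y ltac:(lra)) as [m [Hm _]].
    { intros u _. apply continuity_pt_filterlim.
      apply (continuous_comp g Rabs); [apply Hg|]. apply continuous_Rabs. }
    set (M := Rabs (g m)) in Hm.
    assert (HL : is_lim_seq (fun N => 20 * M * (ln (1 + INR N) / (1 + INR N))) 0).
    { replace (Finite 0) with (Rbar_mult (20 * M) 0)
        by (simpl; f_equal; ring).
      apply is_lim_seq_scal_l, is_lim_seq_ln_over. }
    apply is_lim_seq_abs_0.
    apply is_lim_seq_le_le_loc with (fun _ => 0)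
      (fun N => 20 * M * (ln (1 + INR N) / (1 + INR N)));
      [|apply is_lim_seq_const|exact HL].
    exists 1%nat. intros N HN. split; [apply Rabs_pos|].
    now apply (sawtooth_error_integral g N n).
Qed.

(** The sawtooth series may be integrated term by term against a function that is
    only continuous, because its partial sums converge to [psi] in the mean. *)
Lemma sine_series_unit (g : R -> R) (x y : R) :
  (forall u, continuous g u) -> 0 < x -> x <= y ->
  is_lim_seq (fun N => sum_n_m (fun k =>
      / INR k * RInt (fun u => g u * sin (2 * PI * INR k * u)) x y) 1 N)
    (- PI * RInt (fun u => psi u * g u) x y).
Proof.
  intros Hg Hx [Hxy|<-].
  - pose proof (sawtooth_error_lim g x y Hg Hx Hxy) as H.
    pose proof (is_lim_seq_scal_l _ PI _ H) as H'.
    replace (Rbar_mult PI 0) with (Finite 0) in H' by (simpl; f_equal; ring).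
    set (J := RInt (fun u => psi u * g u) x y).
    pose proof (is_lim_seq_plus' _ _ _ _ H' (is_lim_seq_const (- PI * J))) as H2.
    rewrite Rplus_0_l in H2. eapply is_lim_seq_ext; [|exact H2]. intros N. simpl.
    assert (E : is_RInt (fun u => (psi u + / PI * sine_sum N u) * g u) x y
      (J + / PI * sum_n_m (fun k =>
         / INR k * RInt (fun u => g u * sin (2 * PI * INR k * u)) x y) 1 N)).
    { apply is_RInt_ext with (fun u => psi u * g u + / PI *
        sum_n_m (fun k => / INR k * (g u * sin (2 * PI * INR k * u))) 1 N).
      { intros u _. unfold sine_sum.
        rewrite (sum_n_m_ext _ (fun k => g u * (/ INR k * sin (2 * PI * INR k * u))))
          by (intros; eq_in_R; ring).
        rewrite sum_n_m_Rmult. eq_in_R. ring. }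
      apply is_RInt_Rplus.
      - apply (RInt_correct (V := R_CompleteNormedModule)).
        apply ex_RInt_cellwise; [|lra|lra]. apply cellwise_mult.
        + apply cellwise_psi.
        + apply cellwise_of_continuous. intros u _. apply Hg.
      - apply is_RInt_Rmult, is_RInt_sum_n_m. intros k _. apply is_RInt_Rmult.
        apply is_RInt_cont. intros u. apply continuous_Rmult; [apply Hg|].
        apply (ex_derive_continuous (V := R_NormedModule)). now auto_derive. }
    rewrite (is_RInt_unique (V := R_CompleteNormedModule) _ _ _ _ E).
    eq_in_R. field. apply PI_neq0.
  - rewrite RInt_point. change (@zero R_CompleteNormedModule) with 0.
    rewrite Rmult_0_r.
    apply is_lim_seq_ext with (fun _ => 0); [|apply is_lim_seq_const].
    intros N. rewrite (sum_n_m_ext _ (fun _ => zero)).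
    + symmetry. apply (sum_n_m_const_zero (G := R_AbelianMonoid)).
    + intros k. rewrite RInt_point. apply Rmult_0_r.
Qed.

Lemma RInt_rescale (h : R -> R) (c x y : R) : 0 < c -> ex_RInt h x y ->
  RInt h x y = RInt (fun t => c * h (c * t)) (x / c) (y / c).
Proof.
  intros Hc Hex.
  replace x with (c * (x / c) + 0) in Hex |- * at 1 by (field; lra).
  replace y with (c * (y / c) + 0) in Hex |- * at 1 by (field; lra).
  rewrite <- (RInt_comp_lin (V := R_CompleteNormedModule) h c 0 (x / c) (y / c) Hex).
  apply RInt_ext. intros t _. now rewrite Rplus_0_r.
Qed.

Lemma continuous_rescale (g : R -> R) (c : R) :
  (forall u, continuous g u) -> forall t, continuous (fun t => c * g (c * t)) t.
Proof.
  intros Hg t. apply continuous_Rmult; [apply continuous_const|].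
  apply (continuous_comp (fun t => c * t) g); [|apply Hg].
  apply continuous_Rmult; [apply continuous_const|apply continuous_id].
Qed.

Lemma is_series_of_sum_from_1 (b : nat -> R) (l : R) :
  is_lim_seq (sum_n_m b 1) l -> is_series (fun k => b (S k)) l.
Proof.
  intros H. apply is_lim_seq_incr_1 in H.
  apply (is_lim_seq_ext _ (sum_n (fun k => b (S k)))) in H; [exact H|].
  intros N. unfold sum_n. symmetry. apply sum_n_m_S.
Qed.

Lemma div_pos_le (c x y : R) : 0 < c -> 0 < x -> x <= y -> 0 < x / c /\ x / c <= y / c.
Proof.
  intros Hc Hx Hxy. assert (0 < / c) by now apply Rinv_0_lt_compat.
  split; [now apply Rdiv_lt_0_compat|]. apply Rmult_le_compat_r; lra.
Qed.

Lemma ex_series_fourier_abs (g : R -> R) (m : nat) (theta x y : R) :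
  (forall u, continuous g u) -> (1 <= m)%nat -> 0 < x -> x <= y ->
  ex_series (fun k => / INR (S k) *
    Rabs (RInt (fun u => g u * cos (2 * PI * INR (S k) * u / INR m + theta)) x y)).
Proof.
  intros Hg Hm Hx Hxy. assert (Hm' : 0 < INR m) by (apply lt_0_INR; lia).
  destruct (div_pos_le _ x y Hm' Hx Hxy) as [Hx' Hxy'].
  set (g1 := fun t => INR m * g (INR m * t)).
  destruct (fourier_coeff_sum_bounded g1 theta (x / INR m) (y / INR m)
    (continuous_rescale g (INR m) Hg) ltac:(lra) Hxy') as [M HM].
  set (b := fun k => / INR k *
    Rabs (RInt (fun u => g1 u * wave theta k u) (x / INR m) (y / INR m))) in HM.
  destruct (ex_finite_lim_seq_incr (sum_n_m b 1) M) as [l Hl].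
  - intros n. rewrite sum_n_Sm by lia. change plus with Rplus.
    assert (0 <= b (S n)).
    { apply Rmult_le_pos; [|apply Rabs_pos].
      left. apply Rinv_0_lt_compat, lt_0_INR. lia. }
    lra.
  - exact HM.
  - exists l. eapply is_series_ext; [|apply is_series_of_sum_from_1, Hl].
    intros k. unfold b. f_equal. f_equal. symmetry.
    rewrite (RInt_rescale _ (INR m)); [|exact Hm'|].
    + apply RInt_ext. intros t _. unfold g1, wave.
      replace (2 * PI * INR (S k) * (INR m * t) / INR m)
        with (2 * PI * INR (S k) * t) by (field; lra).
      eq_in_R. ring.
    + apply ex_RInt_cont. intros u. apply continuous_Rmult; [apply Hg|].
      apply (ex_derive_continuous (V := R_NormedModule)). auto_derive. lra.
Qed.

Lemma is_series_fourier_sin (g : R -> R) (m : nat) (x y : R) :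
  (forall u, continuous g u) -> (1 <= m)%nat -> 0 < x -> x <= y ->
  is_series (fun k => / INR (S k) *
      RInt (fun u => g u * sin (2 * PI * INR (S k) * u / INR m)) x y)
    (- PI * RInt (fun u => psi (u / INR m) * g u) x y).
Proof.
  intros Hg Hm Hx Hxy. assert (Hm' : 0 < INR m) by (apply lt_0_INR; lia).
  destruct (div_pos_le _ x y Hm' Hx Hxy) as [Hx' Hxy'].
  set (g1 := fun t => INR m * g (INR m * t)).
  pose proof (sine_series_unit g1 (x / INR m) (y / INR m)
    (continuous_rescale g (INR m) Hg) Hx' Hxy') as H.
  apply is_series_of_sum_from_1 in H.
  rewrite (RInt_rescale _ (INR m)); [|exact Hm'|].
  - rewrite (RInt_ext _ (fun u => psi u * g1 u)).
    + eapply is_series_ext; [|exact H]. intros k. cbv beta. f_equal. symmetry.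
      rewrite (RInt_rescale _ (INR m)); [|exact Hm'|].
      * apply RInt_ext. intros t _. unfold g1.
        replace (2 * PI * INR (S k) * (INR m * t) / INR m)
          with (2 * PI * INR (S k) * t) by (field; lra).
        eq_in_R. ring.
      * apply ex_RInt_cont. intros u. apply continuous_Rmult; [apply Hg|].
        apply (ex_derive_continuous (V := R_NormedModule)). auto_derive. lra.
    + intros t _. unfold g1.
      replace (INR m * t / INR m) with t by (field; lra). eq_in_R. ring.
  - apply ex_RInt_cellwise; [|lra|lra]. apply cellwise_mult.
    + now apply cellwise_psi_div.
    + apply cellwise_of_continuous. intros u _. apply Hg.
Qed.

(** * Complex functions on a compact interval *)

Definition C1_on_real (a b : R) (p p' : R -> R) : Prop :=
  (forall x, a <= x <= b ->
     filterdiff (U := R_NormedModule) (V := R_NormedModule)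
       p (within (fun u => a <= u <= b) (locally x)) (fun h => scal h (p' x))) /\
  continuous_on (fun u => a <= u <= b) p'.

Lemma C1_on_fst (a b : R) (f f' : R -> C) :
  C1_on a b f f' -> C1_on_real a b (fun u => fst (f u)) (fun u => fst (f' u)).
Proof.
  intros [H1 H2]. split.
  - intros x Hx.
    apply (filterdiff_comp (V := C_R_NormedModule) f fst _ fst (H1 x Hx)).
    apply filterdiff_linear.
    apply (is_linear_fst (U := R_NormedModule) (V := R_NormedModule)).
  - intros x Hx. eapply filterlim_comp; [exact (H2 x Hx)|].
    destruct (f' x) as [u v]. apply (continuous_fst (U := R_UniformSpace)).
Qed.

Lemma C1_on_snd (a b : R) (f f' : R -> C) :
  C1_on a b f f' -> C1_on_real a b (fun u => snd (f u)) (fun u => snd (f' u)).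
Proof.
  intros [H1 H2]. split.
  - intros x Hx.
    apply (filterdiff_comp (V := C_R_NormedModule) f snd _ snd (H1 x Hx)).
    apply filterdiff_linear.
    apply (is_linear_snd (U := R_NormedModule) (V := R_NormedModule)).
  - intros x Hx. eapply filterlim_comp; [exact (H2 x Hx)|].
    destruct (f' x) as [u v]. apply (continuous_snd (U := R_UniformSpace)).
Qed.

Definition clamp (a b u : R) : R := Rmax a (Rmin u b).

Lemma clamp_in (a b u : R) : a <= b -> a <= clamp a b u <= b.
Proof.
  intros H. unfold clamp. split; [apply Rmax_l|].
  apply Rmax_lub; [exact H|apply Rmin_r].
Qed.

Lemma clamp_id (a b u : R) : a <= u <= b -> clamp a b u = u.
Proof. intros H. unfold clamp. rewrite Rmin_left, Rmax_right; lra. Qed.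

Lemma clamp_lipschitz (a b u v : R) : Rabs (clamp a b u - clamp a b v) <= Rabs (u - v).
Proof.
  apply Rabs_le_between.
  pose proof (Rle_abs (u - v)). pose proof (Rle_abs (v - u)) as H'.
  rewrite Rabs_minus_sym in H'. unfold clamp, Rmin.
  destruct (Rle_dec u b), (Rle_dec v b); unfold Rmax;
    repeat match goal with |- context [Rle_dec ?p ?q] => destruct (Rle_dec p q) end;
    lra.
Qed.

Lemma continuous_clamp (p : R -> R) (a b : R) : a <= b ->
  (forall x, a <= x <= b ->
     filterlim p (within (fun u => a <= u <= b) (locally x)) (locally (p x))) ->
  forall u, continuous (fun v => p (clamp a b v)) u.
Proof.
  intros Hab Hp u. eapply filterlim_comp; [|apply (Hp _ (clamp_in a b u Hab))].
  intros P [eps HP]. exists eps. intros v Hv.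
  apply HP; [|now apply clamp_in].
  eapply Rle_lt_trans; [apply clamp_lipschitz|exact Hv].
Qed.

Lemma C1_on_real_continuous (a b : R) (p p' : R -> R) (x : R) :
  C1_on_real a b p p' -> a <= x <= b ->
  filterlim p (within (fun u => a <= u <= b) (locally x)) (locally (p x)).
Proof.
  intros [H _] Hx.
  apply (filterdiff_continuous_aux (U := R_NormedModule) (V := R_NormedModule)).
  - eexists. now apply H.
  - intros P HP. unfold within. apply (filter_imp P); auto.
Qed.

(** Near an interior point the filter relative to [[a, b]] is the full
    neighbourhood filter. *)
Lemma C1_on_real_derive (a b : R) (p p' : R -> R) (x : R) :
  C1_on_real a b p p' -> a < x < b -> is_derive p x (p' x).
Proof.
  intros [H _] Hx. destruct (H x ltac:(lra)) as [Hl Hd]. split; [exact Hl|].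
  intros y Hy eps.
  apply (is_filter_lim_locally_unique (V := R_NormedModule)) in Hy. subst y.
  assert (Hw : is_filter_lim (T := R_NormedModule)
    (within (fun u => a <= u <= b) (locally x)) x).
  { intros P HP. unfold within. apply (filter_imp P); auto. }
  specialize (Hd x Hw eps). unfold within in Hd.
  assert (Hn : locally x (fun u => a < u /\ u < b)).
  { apply filter_and; [apply open_gt|apply open_lt]; lra. }
  generalize (filter_and _ _ Hd Hn). apply filter_imp.
  intros u [Hu1 Hu2]. apply Hu1. lra.
Qed.

(** The derivatives in the hypothesis are one-sided at [a] and [b], whereas the
    fundamental theorem of calculus in the form used above wants two-sided ones.
    Integrating the derivative extended by constants gives a function on the whole
    line that agrees with [p] on [[a, b]] by the mean value theorem. *)
Lemma C1_extension (a b : R) (p p' : R -> R) : a < b -> C1_on_real a b p p' ->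
  exists phi phi' : R -> R,
    (forall u, is_derive phi u (phi' u)) /\ (forall u, continuous phi' u) /\
    (forall u, a <= u <= b -> p u = phi u /\ p' u = phi' u).
Proof.
  intros Hab Hp. set (phi' := fun u => p' (clamp a b u)).
  assert (Hc : forall u, continuous phi' u).
  { apply continuous_clamp; [lra|]. intros x Hx. now apply (proj2 Hp). }
  set (phi := fun u => p a + RInt phi' a u).
  assert (Hd : forall u, is_derive phi u (phi' u)).
  { intros u. unfold phi. replace (phi' u) with (0 + phi' u) by ring.
    apply (is_derive_plus (V := R_NormedModule)).
    { apply (is_derive_const (V := R_NormedModule) (p a) u). }
    apply (is_derive_RInt (V := R_NormedModule) phi' (RInt phi' a) a u); [|apply Hc].
    apply filter_forall. intros v. apply is_RInt_cont, Hc. }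
  exists phi, phi'. split; [exact Hd|]. split; [exact Hc|].
  intros u Hu. split; [|unfold phi'; now rewrite clamp_id].
  set (h := fun v => p (clamp a b v) - phi v).
  destruct (proj1 Hu) as [Hau|<-].
  2:{ unfold phi. rewrite RInt_point. change (@zero _) with 0. symmetry. apply Rplus_0_r. }
  destruct (MVT_gen h a u (fun _ => 0)) as [v [_ E]].
  - intros v. rewrite Rmin_left, Rmax_right by lra. intros Hv.
    replace 0 with (p' v - phi' v) by (unfold phi'; rewrite clamp_id by lra; ring).
    apply (is_derive_minus (V := R_NormedModule)); [|apply Hd].
    apply is_derive_ext_loc with p.
    + assert (Hn : locally v (fun u => a < u /\ u < b)).
      { apply filter_and; [apply open_gt|apply open_lt]; lra. }
      revert Hn. apply filter_imp. intros w Hw. rewrite clamp_id; [reflexivity|lra].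
    + apply (C1_on_real_derive a b); [exact Hp|lra].
  - intros v _. apply continuity_pt_filterlim.
    apply (continuous_minus (V := R_NormedModule)).
    + apply continuous_clamp; [lra|]. intros x Hx.
      now apply (C1_on_real_continuous a b p p').
    + apply (ex_derive_continuous (V := R_NormedModule)). now exists (phi' v).
  - unfold h in E. rewrite !clamp_id in E by lra.
    assert (Ea : phi a = p a).
    { unfold phi. rewrite RInt_point. apply Rplus_0_r. }
    lra.
Qed.

Lemma RIntC_pair (F : R -> C) (G1 G2 : R -> R) (x y : R) :
  x <= y -> ex_RInt G1 x y -> ex_RInt G2 x y ->
  (forall u, x < u < y -> F u = (G1 u, G2 u)) ->
  RIntC F x y = (RInt G1 x y, RInt G2 x y).
Proof.
  intros Hxy H1 H2 HF.
  apply (is_RInt_unique (V := C_R_CompleteNormedModule)).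
  apply (is_RInt_ext (V := C_R_NormedModule) (fun u => (G1 u, G2 u))).
  { intros u. rewrite Rmin_left, Rmax_right by lra. intros Hu. now rewrite HF. }
  apply (is_RInt_fct_extend_pair (U := R_NormedModule) (V := R_NormedModule));
    now apply (RInt_correct (V := R_CompleteNormedModule)).
Qed.

Lemma sum_n_m_pair (F : nat -> C) (n m : nat) :
  sum_n_m (G := C_AbelianMonoid) F n m =
  (sum_n_m (fun k => fst (F k)) n m, sum_n_m (fun k => snd (F k)) n m).
Proof.
  destruct (Nat.lt_ge_cases m n) as [H|H].
  { now rewrite !sum_n_m_zero by lia. }
  induction m as [|m IH].
  - replace n with 0%nat by lia. rewrite !sum_n_n. apply surjective_pairing.
  - destruct (Nat.eq_dec n (S m)) as [->|Hn].
    + rewrite !sum_n_n. apply surjective_pairing.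
    + rewrite !sum_n_Sm, IH by lia. reflexivity.
Qed.

Lemma phase_pair (r u c : R) : c <> 0 ->
  Cexp (2 * PI * Ci * r * u / c)%C =
  (cos (2 * PI * r * u / c), sin (2 * PI * r * u / c)).
Proof.
  intros Hc.
  replace (2 * PI * Ci * r * u / c)%C with ((0, 2 * PI * r * u / c) : C).
  - unfold Cexp. simpl. rewrite exp_0. f_equal; ring.
  - unfold Cdiv. rewrite <- RtoC_inv by exact Hc.
    apply injective_projections; simpl; field; exact Hc.
Qed.

Definition cos_coeff (h : R -> R) (m : nat) (x y r : R) : R :=
  RInt (fun u => h u * cos (2 * PI * r * u / INR m)) x y.
Definition sin_coeff (h : R -> R) (m : nat) (x y r : R) : R :=
  RInt (fun u => h u * sin (2 * PI * r * u / INR m)) x y.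

Lemma cos_coeff_opp (h : R -> R) (m : nat) (x y r : R) :
  cos_coeff h m x y (- r) = cos_coeff h m x y r.
Proof.
  unfold cos_coeff. apply RInt_ext. intros u _. rewrite <- cos_neg.
  do 2 f_equal. unfold Rdiv. ring.
Qed.

Lemma sin_coeff_opp (h : R -> R) (m : nat) (x y r : R) : (1 <= m)%nat ->
  (forall u, continuous h u) ->
  sin_coeff h m x y (- r) = - sin_coeff h m x y r.
Proof.
  intros Hm Hh. unfold sin_coeff.
  assert (Hm' : 0 < INR m) by (apply lt_0_INR; lia).
  assert (H := is_RInt_Rmult (fun u => h u * sin (2 * PI * r * u / INR m)) (-1) x y _
    (is_RInt_cont _ x y (fun u => continuous_Rmult _ _ u (Hh u)
      (ex_derive_continuous (V := R_NormedModule) _ _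
        (ltac:(auto_derive; lra) : ex_derive (fun u => sin (2 * PI * r * u / INR m)) u))))).
  rewrite <- (Rmult_1_l (RInt (fun u => h u * sin (2 * PI * r * u / INR m)) x y)).
  rewrite Ropp_mult_distr_l.
  apply (is_RInt_unique (V := R_CompleteNormedModule)).
  eapply is_RInt_ext; [|exact H].
  intros u _. cbv beta.
  replace (2 * PI * - r * u / INR m) with (- (2 * PI * r * u / INR m))
    by (field; lra).
  rewrite sin_neg. eq_in_R. ring.
Qed.

Lemma ex_RInt_trig (h trig : R -> R) (c x y : R) : c <> 0 ->
  (forall u, continuous h u) -> (forall u, ex_derive trig u) ->
  forall r, ex_RInt (fun u => h u * trig (2 * PI * r * u / c)) x y.
Proof.
  intros Hc Hh Ht r. apply ex_RInt_cont. intros u.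
  apply continuous_Rmult; [apply Hh|].
  apply (ex_derive_continuous (V := R_NormedModule)).
  apply ex_derive_comp; [apply Ht|]. now auto_derive.
Qed.

Lemma ex_derive_cos (u : R) : ex_derive cos u.
Proof. now auto_derive. Qed.
Lemma ex_derive_sin (u : R) : ex_derive sin u.
Proof. now auto_derive. Qed.

Lemma fourier_term_pair (a b : R) (f' : R -> C) (p q : R -> R) (m : nat) (v : Z) :
  (forall u, continuous p u) -> (forall u, continuous q u) ->
  (forall u, a <= u <= b -> f' u = (p u, q u)) ->
  (1 <= m)%nat -> v <> 0%Z -> Rmax (INR m ^ 2) a <= b ->
  let x := Rmax (INR m ^ 2) a in
  fourier_term a b f' m v =
  (/ IZR v * (cos_coeff p m x b (IZR v) - sin_coeff q m x b (IZR v)),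
   / IZR v * (cos_coeff q m x b (IZR v) + sin_coeff p m x b (IZR v))).
Proof.
  intros Hp Hq Hf Hm Hv Hx x.
  assert (Hm' : INR m <> 0) by (apply not_0_INR; lia).
  assert (Hv' : IZR v <> 0) by now apply not_0_IZR.
  unfold fourier_term. fold x.
  pose proof (is_RInt_Rplus _ _ _ _ _ _
    (RInt_correct (V := R_CompleteNormedModule) _ _ _
      (ex_RInt_trig p cos (INR m) x b Hm' Hp ex_derive_cos (IZR v)))
    (is_RInt_Rmult _ (-1) _ _ _ (RInt_correct (V := R_CompleteNormedModule) _ _ _
      (ex_RInt_trig q sin (INR m) x b Hm' Hq ex_derive_sin (IZR v))))) as H1.
  pose proof (is_RInt_Rplus _ _ _ _ _ _
    (RInt_correct (V := R_CompleteNormedModule) _ _ _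
      (ex_RInt_trig q cos (INR m) x b Hm' Hq ex_derive_cos (IZR v)))
    (RInt_correct (V := R_CompleteNormedModule) _ _ _
      (ex_RInt_trig p sin (INR m) x b Hm' Hp ex_derive_sin (IZR v)))) as H2.
  rewrite (RIntC_pair _ _ _ x b Hx (ex_intro _ _ H1) (ex_intro _ _ H2)).
  - rewrite (is_RInt_unique (V := R_CompleteNormedModule) _ _ _ _ H1).
    rewrite (is_RInt_unique (V := R_CompleteNormedModule) _ _ _ _ H2).
    fold (cos_coeff p m x b (IZR v)) (cos_coeff q m x b (IZR v)).
    fold (sin_coeff p m x b (IZR v)) (sin_coeff q m x b (IZR v)).
    rewrite <- RtoC_inv by exact Hv'.
    apply injective_projections; simpl; ring.
  - intros u Hu. rewrite phase_pair by exact Hm'.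
    pose proof (Rmax_r (INR m ^ 2) a). fold x in H.
    rewrite Hf by lra. apply injective_projections; simpl; ring.
Qed.

Lemma Cmod_le_sum (x y : R) : Cmod (x, y) <= Rabs x + Rabs y.
Proof.
  replace ((x, y) : C) with (RtoC x + (0, y))%C
    by (apply injective_projections; simpl; ring).
  eapply Rle_trans; [apply Cmod_triangle|]. rewrite Cmod_R.
  apply Rplus_le_compat_l. unfold Cmod. simpl.
  replace (0 * (0 * 1) + y * (y * 1)) with (Rsqr y) by (unfold Rsqr; ring).
  rewrite sqrt_Rsqr_abs. lra.
Qed.

Lemma ex_series_cos_coeff (h : R -> R) (m : nat) (x y : R) :
  (forall u, continuous h u) -> (1 <= m)%nat -> 0 < x -> x <= y ->
  ex_series (fun k => / INR (S k) * Rabs (cos_coeff h m x y (INR (S k)))).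
Proof.
  intros Hh Hm Hx Hxy.
  eapply ex_series_ext; [|apply (ex_series_fourier_abs h m 0 x y Hh Hm Hx Hxy)].
  intros k. unfold cos_coeff. cbv beta. do 2 f_equal.
  apply RInt_ext. intros u _. now rewrite Rplus_0_r.
Qed.

Lemma ex_series_sin_coeff (h : R -> R) (m : nat) (x y : R) :
  (forall u, continuous h u) -> (1 <= m)%nat -> 0 < x -> x <= y ->
  ex_series (fun k => / INR (S k) * Rabs (sin_coeff h m x y (INR (S k)))).
Proof.
  intros Hh Hm Hx Hxy.
  eapply ex_series_ext;
    [|apply (ex_series_fourier_abs h m (- (PI / 2)) x y Hh Hm Hx Hxy)].
  intros k. unfold sin_coeff. cbv beta. do 2 f_equal.
  apply RInt_ext. intros u _. rewrite cos_plus, cos_neg, sin_neg, cos_PI2, sin_PI2.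
  eq_in_R. ring.
Qed.

Lemma fourier_terms_opposite (a b : R) (f' : R -> C) (p q : R -> R) (m k : nat) :
  (forall u, continuous p u) -> (forall u, continuous q u) ->
  (forall u, a <= u <= b -> f' u = (p u, q u)) ->
  (1 <= m)%nat -> Rmax (INR m ^ 2) a <= b ->
  let x := Rmax (INR m ^ 2) a in
  let r := INR (S k) in
  fourier_term a b f' m (Z.of_nat (S k)) =
  (/ r * (cos_coeff p m x b r - sin_coeff q m x b r),
   / r * (cos_coeff q m x b r + sin_coeff p m x b r)) /\
  fourier_term a b f' m (- Z.of_nat (S k)) =
  (- / r * (cos_coeff p m x b r + sin_coeff q m x b r),
   - / r * (cos_coeff q m x b r - sin_coeff p m x b r)).
Proof.
  intros Hp Hq Hf Hm Hx x r. split.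
  - rewrite (fourier_term_pair a b f' p q) by (auto; lia).
    now rewrite <- INR_IZR_INZ.
  - rewrite (fourier_term_pair a b f' p q) by (auto; lia).
    rewrite opp_IZR, <- INR_IZR_INZ. fold x r.
    rewrite !cos_coeff_opp, !sin_coeff_opp by auto.
    assert (0 < r) by (apply lt_0_INR; lia).
    f_equal; field; lra.
Qed.

Lemma fourier_nz_summable (a b : R) (f' : R -> C) (p q : R -> R) (m : nat) :
  (forall u, continuous p u) -> (forall u, continuous q u) ->
  (forall u, a <= u <= b -> f' u = (p u, q u)) ->
  0 < a -> (1 <= m)%nat -> Rmax (INR m ^ 2) a <= b ->
  nz_summable (fourier_term a b f' m).
Proof.
  intros Hp Hq Hf Ha Hm Hx. pose proof (Rmax_r (INR m ^ 2) a) as Hxa.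
  set (x := Rmax (INR m ^ 2) a) in *.
  pose proof (ex_series_cos_coeff p m x b Hp Hm ltac:(lra) Hx) as E1.
  pose proof (ex_series_cos_coeff q m x b Hq Hm ltac:(lra) Hx) as E2.
  pose proof (ex_series_sin_coeff p m x b Hp Hm ltac:(lra) Hx) as E3.
  pose proof (ex_series_sin_coeff q m x b Hq Hm ltac:(lra) Hx) as E4.
  pose proof (ex_series_scal (V := R_NormedModule) 2 _
    (ex_series_plus _ _ (ex_series_plus _ _ E1 E2) (ex_series_plus _ _ E3 E4))) as E.
  refine (ex_series_le (V := R_CompleteNormedModule) _ _ _ E).
  intros k. unfold norm; simpl. unfold abs; simpl.
  rewrite Rabs_pos_eq by (apply Rplus_le_le_0_compat; apply Cmod_ge_0).
  destruct (fourier_terms_opposite a b f' p q m k Hp Hq Hf Hm Hx) as [F1 F2].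
  fold x in F1, F2. simpl in F1, F2.
  rewrite F1, F2. unfold scal, plus, mult; simpl. unfold mult; simpl.
  set (r := match k with 0%nat => 1 | S _ => INR k + 1 end).
  assert (Hr : 0 < / r).
  { apply Rinv_0_lt_compat. change r with (INR (S k)). apply lt_0_INR; lia. }
  generalize (cos_coeff p m x b r), (cos_coeff q m x b r),
    (sin_coeff p m x b r), (sin_coeff q m x b r). intros c1 c2 s1 s2.
  assert (B : forall t z, Rabs t = / r -> Rabs (t * z) = / r * Rabs z).
  { intros t z Ht. now rewrite Rabs_mult, Ht. }
  assert (Bp : Rabs (/ r) = / r) by (apply Rabs_pos_eq; lra).
  assert (Bn : Rabs (- / r) = / r) by now rewrite Rabs_Ropp.
  pose proof (Cmod_le_sum (/ r * (c1 - s2)) (/ r * (c2 + s1))) as T1.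
  pose proof (Cmod_le_sum (- / r * (c1 + s2)) (- / r * (c2 - s1))) as T2.
  rewrite !B in T1, T2 by assumption.
  pose proof (Rabs_triang c1 (- s2)) as A1. pose proof (Rabs_triang c2 s1) as A2.
  pose proof (Rabs_triang c1 s2) as A3. pose proof (Rabs_triang c2 (- s1)) as A4.
  rewrite Rabs_Ropp in A1, A4. unfold Rminus in *. nra.
Qed.

(** In the terms of index [k] and [-k] the cosines cancel, leaving twice [Ci]
    times the sine coefficient; the sawtooth series sums these. *)
Lemma fourier_nz_sum (a b : R) (f' : R -> C) (p q : R -> R) (m : nat) :
  (forall u, continuous p u) -> (forall u, continuous q u) ->
  (forall u, a <= u <= b -> f' u = (p u, q u)) ->
  0 < a -> (1 <= m)%nat -> Rmax (INR m ^ 2) a <= b ->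
  nz_sum (fourier_term a b f' m) =
  (2 * PI * RInt (fun u => psi (u / INR m) * q u) (Rmax (INR m ^ 2) a) b,
   -2 * PI * RInt (fun u => psi (u / INR m) * p u) (Rmax (INR m ^ 2) a) b).
Proof.
  intros Hp Hq Hf Ha Hm Hx. pose proof (Rmax_r (INR m ^ 2) a) as Hxa.
  assert (S : forall h s, (forall u, continuous h u) ->
    is_series (fun k => s * (/ INR (S k) * sin_coeff h m (Rmax (INR m ^ 2) a) b (INR (S k))))
      (s * (- PI * RInt (fun u => psi (u / INR m) * h u) (Rmax (INR m ^ 2) a) b))).
  { intros h s Hh. apply (is_series_scal (V := R_NormedModule) s).
    apply is_series_fourier_sin; auto; lra. }
  unfold nz_sum. f_equal.
  - replace (2 * PI * _) with
      (-2 * (- PI * RInt (fun u => psi (u / INR m) * q u) (Rmax (INR m ^ 2) a) b))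
      by ring.
    apply is_series_unique. eapply is_series_ext; [|apply (S q (-2) Hq)].
    intros k. cbv beta.
    destruct (fourier_terms_opposite a b f' p q m k Hp Hq Hf Hm Hx) as [-> ->].
    unfold Re. cbn [fst snd Cplus]. eq_in_R. ring.
  - replace (-2 * PI * _) with
      (2 * (- PI * RInt (fun u => psi (u / INR m) * p u) (Rmax (INR m ^ 2) a) b))
      by ring.
    apply is_series_unique. eapply is_series_ext; [|apply (S p 2 Hp)].
    intros k. cbv beta.
    destruct (fourier_terms_opposite a b f' p q m k Hp Hq Hf Hm Hx) as [-> ->].
    unfold Im. cbn [fst snd Cplus]. eq_in_R. ring.
Qed.

(** * The summation formula *)

Lemma RIntC_weight (w : R -> R) (F f : R -> C) (p q : R -> R) (a b : R) :
  0 < a -> a <= b -> cellwise_continuous w ->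
  (forall u, continuous p u) -> (forall u, continuous q u) ->
  (forall u, a < u < b -> f u = (p u, q u)) ->
  (forall u, a < u < b -> F u = (RtoC (w u) * f u)%C) ->
  RIntC F a b = (RInt (fun u => w u * p u) a b, RInt (fun u => w u * q u) a b).
Proof.
  intros Ha Hab Hw Hp Hq Hf HF. apply RIntC_pair; auto.
  - apply ex_RInt_cellwise; auto. apply cellwise_mult; auto.
    apply cellwise_of_continuous; auto.
  - apply ex_RInt_cellwise; auto. apply cellwise_mult; auto.
    apply cellwise_of_continuous; auto.
  - intros u Hu. rewrite HF, Hf by exact Hu.
    apply injective_projections; simpl; ring.
Qed.

Lemma sum_Ioc_weight (d : nat -> R) (f : R -> C) (p q : R -> R) (a b : R) :
  0 <= a -> a <= b -> (forall u, a <= u <= b -> f u = (p u, q u)) ->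
  sum_Ioc (fun n => RtoC (d n) * f (INR n))%C a b =
  (sum_Ioc (fun n => d n * p (INR n)) a b, sum_Ioc (fun n => d n * q (INR n)) a b).
Proof.
  intros Ha Hab Hf. unfold sum_Ioc. fold (floorN a) (floorN b).
  rewrite sum_n_m_pair.
  assert (H : forall k, (S (floorN a) <= k <= floorN b)%nat ->
    f (INR k) = (p (INR k), q (INR k))).
  { intros k [H1 H2]. apply Hf. apply le_INR in H1, H2.
    pose proof (floorN_bound a Ha). pose proof (floorN_bound b ltac:(lra)). lra. }
  apply (f_equal2 pair); apply sum_n_m_ext_loc; intros k Hk; rewrite (H k Hk); simpl; ring.
Qed.

Lemma inv_PI_i_mult (A B : R) :
  (1 / (PI * Ci) * (2 * PI * A, -2 * PI * B)%R = (-2 * B, -2 * A)%R)%C.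
Proof.
  pose proof PI_neq0. apply injective_projections; simpl; field; lra.
Qed.

Theorem theorem2 (a b : R) (f f' : R -> C)
  (ha : 0 < a) (hab : a < b) (hf : C1_on a b f f') :
  (forall m : nat, (1 <= m)%nat -> INR m <= sqrt b ->
     nz_summable (fourier_term a b f' m)) /\
  sum_Ioc (fun n => INR (num_divisors n) * f (INR n))%C a b =
  (RIntC (fun u => (ln u + 2 * euler_gamma)%R * f u) a b
   - 2 * RIntC (fun u => f u * psi2 (sqrt u) / u) a b
   (* minus: the derivative of -2 psi2 (sqrt u); the source prints plus, which
      fails for f = 1 on [1/16, 1/4] *)
   - RIntC (fun u => f u * psi (sqrt u) / sqrt u) a b
   + 4 * RIntC (fun u => f u *
       RInt_gen (fun t => psi2 t / t ^ 3)%R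
         (at_point (sqrt u)) (Rbar_locally p_infty)) a b
   - f b * (psi (sqrt b) ^ 2)%R
   + f a * (psi (sqrt a) ^ 2)%R
   + RIntC (fun u => (psi (sqrt u) ^ 2)%R * f' u) a b
   + 2 * f a * sum_Ioc (fun m => psi (a / INR m)) 0 (sqrt a)
   - 2 * f b * sum_Ioc (fun m => psi (b / INR m)) 0 (sqrt b)
   - 1 / (PI * Ci) *
       sum_Ioc (fun m => nz_sum (fourier_term a b f' m)) 0 (sqrt b))%C.
Proof.
  destruct (C1_extension a b _ _ hab (C1_on_fst a b f f' hf))
    as [p [p' [Dp [Cp' Ep]]]].
  destruct (C1_extension a b _ _ hab (C1_on_snd a b f f' hf))
    as [q [q' [Dq [Cq' Eq]]]].
  assert (Ef : forall u, a <= u <= b -> f u = (p u, q u)).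
  { intros u Hu. apply injective_projections; [apply Ep|apply Eq]; exact Hu. }
  assert (Ef' : forall u, a <= u <= b -> f' u = (p' u, q' u)).
  { intros u Hu. apply injective_projections; [apply Ep|apply Eq]; exact Hu. }
  assert (Cp : forall u, continuous p u).
  { intros u. apply (ex_derive_continuous (V := R_NormedModule)). eexists; apply Dp. }
  assert (Cq : forall u, continuous q u).
  { intros u. apply (ex_derive_continuous (V := R_NormedModule)). eexists; apply Dq. }
  assert (Hmax : forall m, INR m ^ 2 <= b -> Rmax (INR m ^ 2) a <= b).
  { intros m Hm. apply Rmax_lub; lra. }
  split.
  { intros m Hm Hmb. apply (fourier_nz_summable a b f' p' q'); auto.
    apply Hmax. rewrite <- (pow2_sqrt b) by lra.
    apply pow_incr. split; [apply pos_INR|exact Hmb]. }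
  rewrite (sum_Ioc_weight _ f p q) by (auto; lra).
  rewrite (RIntC_weight (fun u => ln u + 2 * euler_gamma) _ f p q a b);
    [|lra|lra|apply cellwise_log_weight|exact Cp|exact Cq
     |intros; apply Ef; lra|reflexivity].
  rewrite (RIntC_weight (fun u => psi2 (sqrt u) * / u) _ f p q a b);
    [|lra|lra| |exact Cp|exact Cq|intros; apply Ef; lra|].
  2:{ apply cellwise_mult; [apply cellwise_psi2_sqrt|apply cellwise_inv]. }
  2:{ intros u Hu. rewrite RtoC_mult, RtoC_inv by lra. unfold Cdiv. ring. }
  rewrite (RIntC_weight (fun u => psi (sqrt u) * / sqrt u) _ f p q a b);
    [|lra|lra| |exact Cp|exact Cq|intros; apply Ef; lra|].
  2:{ apply cellwise_mult; [apply cellwise_psi_sqrt|apply cellwise_inv_sqrt]. }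
  2:{ intros u Hu. pose proof (sqrt_lt_R0 u ltac:(lra)).
      rewrite RtoC_mult, RtoC_inv by lra. unfold Cdiv. ring. }
  rewrite (RIntC_weight (fun u => psi2_tail (sqrt u)) _ f p q a b);
    [|lra|lra|apply cellwise_tail_sqrt|exact Cp|exact Cq|intros; apply Ef; lra|].
  2:{ intros u Hu. rewrite RInt_gen_psi2_tail by (apply sqrt_lt_R0; lra).
      apply Cmult_comm. }
  rewrite (RIntC_weight (fun u => psi (sqrt u) ^ 2) _ f' p' q' a b);
    [|lra|lra|apply cellwise_psi_sqrt_sqr|exact Cp'|exact Cq'
     |intros; apply Ef'; lra|reflexivity].
  set (W := fun (h : R -> R) m =>
    RInt (fun u => psi (u / INR m) * h u) (Rmax (INR m ^ 2) a) b).
  replace (sum_Ioc (fun m => nz_sum (fourier_term a b f' m)) 0 (sqrt b))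
    with ((2 * PI * sum_Ioc (W q') 0 (sqrt b), -2 * PI * sum_Ioc (W p') 0 (sqrt b)) : C).
  2:{ rewrite !(sum_Ioc_0 (G := R_AbelianMonoid)),
        (sum_Ioc_0 (G := C_AbelianMonoid)), sum_n_m_pair, <- !sum_n_m_Rmult.
      assert (E : forall m, (1 <= m <= floorN (sqrt b))%nat ->
        nz_sum (fourier_term a b f' m) = (2 * PI * W q' m, -2 * PI * W p' m)).
      { intros m Hm. apply fourier_nz_sum; auto; [lia|].
        apply Hmax. apply le_floorN_sqrt; [lra|lia]. }
      apply (f_equal2 pair); apply sum_n_m_ext_loc; intros m Hm; now rewrite E. }
  rewrite inv_PI_i_mult, !Ef by lra.
  rewrite (divisor_sum_formula_real p p' a b Dp Cp' ha hab),
    (divisor_sum_formula_real q q' a b Dq Cq' ha hab).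
  fold (W p') (W q').
  assert (Hcomm : forall h w, RInt (fun u => h u * w u) a b
    = RInt (fun u => w u * h u) a b).
  { intros h w. apply RInt_ext. intros; apply Rmult_comm. }
  assert (Hdiv : forall h w v, RInt (fun u => h u * w u / v u) a b
    = RInt (fun u => w u * / v u * h u) a b).
  { intros h w v. apply RInt_ext. intros; unfold Rdiv; eq_in_R; ring. }
  rewrite !Hdiv, (Hcomm p (fun u => psi2_tail (sqrt u))),
    (Hcomm q (fun u => psi2_tail (sqrt u))).
  apply injective_projections; simpl; ring.
Qed.
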